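(* Let $n\geq 3$ and let $\{\pi_i\}_{i=1}^{n-1}$ be a family of polynomial divided difference operators, $\pi_i$ having index $i$, such that for every $1\leq i\leq n-1$ neither the polynomial $Q_0$ nor the polynomial $T$ associated with $\pi_i$ vanishes. Then the cubic braid relations $\pi_i\pi_{i+1}\pi_i=\pi_{i+1}\pi_i\pi_{i+1}$ hold for all $1\leq i\leq n-2$ if and only if the family is as in one of the following two cases. (1) There exist constants $a,b,c,d$, not all $0$ and such that $ad-bc=0$, and another constant $e$ that equals neither $0$ nor $b-c$, such that, uniformly for all $1\leq i\leq n-1$, $$P^{+}(x_i,x_{i+1})=a x_i x_{i+1}+(b-e)x_i+c x_{i+1}+d,\quad Q_{+}(x_i,x_{i+1})=e x_i,\quad R_{+}(x_i,x_{i+1})=0.$$ (2) There exist constants $a,b,c,d$, not all $0$ and such that $ad-bc=0$, such that for every $i$ independently the triple $\big(P^{+}(x_i,x_{i+1}),Q_{+}(x_i,x_{i+1}),R_{+}(x_i,x_{i+1})\big)$ of $\pi_i$ is one of the four triples - $\big(a x_i x_{i+1}+b x_i+c x_{i+1}+d,\ 0,\ 0\big)$; - $\big(a x_i x_{i+1}+c x_i+c x_{i+1}+d,\ (b-c)x_i,\ 0\big)$; - $\big(a x_i^2+(b+c)x_i+c x_{i+1}+d,\ -c x_i,\ -a x_i\big)$; - $\big(c x_{i+1}+d,\ a x_i^2+b x_i,\ -a x_i\big)$.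
   Context: $K$ is a field of arbitrary characteristic over which all polynomials are defined; possible extra parameters are regarded as elements of $K$, so ''constant'' means an element of $K$. The operators act on functions $f$ of variables $x_1,\dots,x_n$ (concretely $f\in K[x_1,\dots,x_n]$). The operator $s_i$ interchanges $x_i$ and $x_{i+1}$, and $\partial_i f=\frac{f-s_i f}{x_i-x_{i+1}}$. A polynomial divided difference operator with index $i$ is an operator of the form $$\pi_i f=\partial_i\big(P(x_i,x_{i+1})f\big)+Q(x_i,x_{i+1})\partial_i f+R(x_i,x_{i+1})f+S(x_i,x_{i+1})s_i f,$$ with two-variable polynomials $P,Q,R,S$ that may differ for different $i$. The polynomials $Q_0(u,v)=P(v,u)+Q(u,v)-(u-v)S(u,v)$ and $T(u,v)=P(u,v)+(u-v)R(u,v)+Q(u,v)$ depend only on the operator, not on the presentation. A monomial $x_i^r x_{i+1}^s$ is $\partial_i$-positive if $r>s$, and a polynomial is $\partial_i$-positive if it is a linear combination of $\partial_i$-positive monomials (in particular $0$ is). Every such operator has a unique presentation with $S=0$ and with $Q$ and $R$ both $\partial_i$-positive; the polynomials $P,Q,R$ in this presentation are denoted $P^{+},Q_{+},R_{+}$, so that $\pi_i f=\partial_i(P^{+}f)+Q_{+}\partial_i f+R_{+}f$. *)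

(* Defs.v *)
From HB Require Import structures.
From mathcomp Require Import all_boot all_order all_fingroup all_algebra.
From mathcomp Require Export mpoly.

Set Implicit Arguments.
Unset Strict Implicit.
Unset Printing Implicit Defensive.

Import GRing.Theory.
Local Open Scope ring_scope.

(* The variables are numbered from 0: an operator index i : 'I_n.-1 stands for
   the adjacent pair of variables numbered i and i.+1. *)
Definition lo n (i : 'I_n.-1) : 'I_n := widen_ord (leq_pred n) i.

Lemma hi_subproof n (i : 'I_n.-1) : (i.+1 < n)%N.
Proof. by rewrite -ltn_predRL. Qed.

Definition hi n (i : 'I_n.-1) : 'I_n := Ordinal (hi_subproof i).

Definition xlo (K : fieldType) n (i : 'I_n.-1) : {mpoly K[n]} := 'X_(lo i).
Definition xhi (K : fieldType) n (i : 'I_n.-1) : {mpoly K[n]} := 'X_(hi i).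
Arguments xlo K {n} i.
Arguments xhi K {n} i.

Definition swap (K : fieldType) n (i : 'I_n.-1) (f : {mpoly K[n]}) :
  {mpoly K[n]} := msym (tperm (lo i) (hi i)) f.

Lemma lo_neq_hi n (i : 'I_n.-1) : lo i != hi i.
Proof. by rewrite -val_eqE /= neq_ltn leqnn. Qed.

Lemma swapX (K : fieldType) n (i : 'I_n.-1) (j : 'I_n) :
  swap i ('X_j : {mpoly K[n]}) = 'X_(tperm (lo i) (hi i) j).
Proof.
rewrite /swap msymX tpermV; congr mpolyX.
apply/mnmP=> k; rewrite mnmE !mnm1E; congr nat_of_bool.
by rewrite -(inj_eq (@perm_inj _ (tperm (lo i) (hi i))) j) tpermK.
Qed.

Lemma ddiff_exists (K : fieldType) n (i : 'I_n.-1) (f : {mpoly K[n]}) :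
  exists g : {mpoly K[n]}, (xlo K i - xhi K i) * g == f - swap i f.
Proof.
pose E (f : {mpoly K[n]}) := exists g, (xlo K i - xhi K i) * g = f - swap i f.
suff [g Eg] : E f by exists g; apply/eqP.
have ED p q : E p -> E q -> E (p + q).
  case=> g Eg [h Eh]; exists (g + h).
  by rewrite mulrDr Eg Eh /swap msymD opprD addrACA.
have EM p q : E p -> E q -> E (p * q).
  case=> g Eg [h Eh]; exists (g * q + swap i p * h).
  rewrite mulrDr mulrA Eg mulrCA Eh mulrBl mulrBr /swap msymM addrA.
  by rewrite subrK.
have EC c : E c%:MP.
  exists 0; rewrite mulr0 /swap.
  have -> : c%:MP = c *: 1 :> {mpoly K[n]} by rewrite -mul_mpolyC mulr1.
  by rewrite msymZ msym1 subrr.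
have EX j : E 'X_j.
  have [->|jl] := eqVneq j (lo i).
    by exists 1; rewrite swapX tpermL mulr1.
  have [->|jh] := eqVneq j (hi i).
    by exists (-1); rewrite swapX tpermR mulrN1 opprB.
  by exists 0; rewrite swapX tpermD 1?eq_sym // mulr0 subrr.
elim/mpolyind: f => [|c m p _ _ Ep]; first by rewrite -mpolyC0.
apply: (ED) => //; rewrite -mul_mpolyC; apply: (EM) => //.
rewrite mpolyXE_id; apply: (big_ind E) => //; first exact: (EC 1).
by move=> j _; elim: (m j) => [|k IH]; [exact: (EC 1) | rewrite exprS; apply: EM].
Qed.

(* The quotient (f - s_i f) / (x_i - x_{i+1}), unique since polynomials over a
   field form an integral domain. *)
Definition ddiff (K : fieldType) n (i : 'I_n.-1) (f : {mpoly K[n]}) :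
  {mpoly K[n]} := xchoose (ddiff_exists i f).

Lemma ddiffE (K : fieldType) n (i : 'I_n.-1) (f : {mpoly K[n]}) :
  (xlo K i - xhi K i) * ddiff i f = f - swap i f.
Proof. exact/eqP/(xchooseP (ddiff_exists i f)). Qed.

Definition ev2 (K : fieldType) n (p : {mpoly K[2]}) (g h : {mpoly K[n]}) :
  {mpoly K[n]} := p \mPo [tuple g; h].

Definition varu (K : fieldType) : {mpoly K[2]} := 'X_ord0.
Definition varv (K : fieldType) : {mpoly K[2]} := 'X_ord_max.

Definition pddo (K : fieldType) n (i : 'I_n.-1) (P Q R S : {mpoly K[2]})
    (f : {mpoly K[n]}) : {mpoly K[n]} :=
  let at_i p := ev2 p (xlo K i) (xhi K i) in
  ddiff i (at_i P * f) + at_i Q * ddiff i f + at_i R * f + at_i S * swap i f.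

Definition polyQ0 (K : fieldType) (P Q S : {mpoly K[2]}) : {mpoly K[2]} :=
  ev2 P (varv K) (varu K) + Q - (varu K - varv K) * S.

Definition polyT (K : fieldType) (P Q R : {mpoly K[2]}) : {mpoly K[2]} :=
  P + (varu K - varv K) * R + Q.

Definition ddiff_positive (K : fieldType) (p : {mpoly K[2]}) : Prop :=
  forall m : 'X_{1..2}, m \in msupp p -> (m ord_max < m ord0)%N.

(* (P, Q, R) is the triple (P^+, Q_+, R_+) of the operator pi of index i. *)
Definition positive_presentation (K : fieldType) n (i : 'I_n.-1)
    (pi : {mpoly K[n]} -> {mpoly K[n]}) (P Q R : {mpoly K[2]}) : Prop :=
  [/\ ddiff_positive Q, ddiff_positive R & forall f, pi f = pddo i P Q R 0 f].

Definition braid_relations (K : fieldType) n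
    (pi : 'I_n.-1 -> {mpoly K[n]} -> {mpoly K[n]}) : Prop :=
  forall i j : 'I_n.-1, j = i.+1 :> nat ->
  forall f, pi i (pi j (pi i f)) = pi j (pi i (pi j f)).

Definition braid_case1 (K : fieldType) n
    (pi : 'I_n.-1 -> {mpoly K[n]} -> {mpoly K[n]}) : Prop :=
  let u := varu K in let v := varv K in
  exists a b c d e : K,
  [/\ ~ [/\ a = 0, b = 0, c = 0 & d = 0], a * d - b * c = 0, e <> 0, e <> b - c
    & forall i, positive_presentation i (pi i)
        (a *: (u * v) + (b - e) *: u + c *: v + d%:MP) (e *: u) 0].

Definition braid_case2 (K : fieldType) n
    (pi : 'I_n.-1 -> {mpoly K[n]} -> {mpoly K[n]}) : Prop :=
  let u := varu K in let v := varv K in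
  exists a b c d : K,
  [/\ ~ [/\ a = 0, b = 0, c = 0 & d = 0], a * d - b * c = 0
    & forall i, let triple := positive_presentation i (pi i) in
      [\/ triple (a *: (u * v) + b *: u + c *: v + d%:MP) 0 0,
          triple (a *: (u * v) + c *: u + c *: v + d%:MP) ((b - c) *: u) 0,
          triple (a *: u ^+ 2 + (b + c) *: u + c *: v + d%:MP)
                 ((- c) *: u) ((- a) *: u)
        | triple (c *: v + d%:MP) (a *: u ^+ 2 + b *: u) ((- a) *: u)]].

(* Main.v *)
Require Import Defs.
From HB Require Import structures.
From mathcomp Require Import all_boot all_order all_fingroup all_algebra.
From mathcomp Require Import ring zify.
Local Open Scope ring_scope.
Set Implicit Arguments.
Unset Strict Implicit.
Unset Printing Implicit Defensive.
Import GRing.Theory.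

(* The operator is pi_i = (x_i - x_{i+1})^-1 (T - Q_0 s_i), so both sides of a
   braid relation are combinations of the six permutations of three variables
   with rational coefficients.  The permutations are linearly independent, so
   the relation amounts to six identities.  They say that T is the same for all
   i, that T satisfies a Yang-Baxter type identity (and so does T(v,u)), that
     T(u,v) T(v,u) - Q_0(u,v) Q_0(v,u) = kappa (u - v)^2
   with one constant kappa for all i, and that the Q_0 of neighbouring operators
   satisfy a cubic relation.  Comparing degrees in the Yang-Baxter identity
   gives T = auv + bu + cv + d with ad = bc, i.e. T = (al u + be) (ga v + de).
   If kappa = 0 then Q_0 is a product of one of al u + be, al v + be and one of
   ga u + de, ga v + de, which gives the four triples of case 2.  If kappa <> 0
   then by degrees Q_0 = auv + (c + e) u + (b - e) v + d with
   kappa = e (e - (b - c)), and the cubic relation excludes that neighbours use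
   the two different roots e of this equation: case 1. *)

(** * Bivariate polynomials *)

Section Evaluation.
Variables (K R : comNzRingType) (iota : {rmorphism K -> R}).

Fact commr_of_comRing (A : nzRingType) (f : {rmorphism A -> R}) (x : R) :
  commr_rmorph f x.
Proof. by move=> a; apply: mulrC. Qed.

(* In {poly {poly K}} the inner variable is u and the outer variable is v. *)
Definition ev (x y : R) (p : {poly {poly K}}) : R :=
  horner_morph (commr_of_comRing (horner_morph (commr_of_comRing iota x)) y) p.

HB.instance Definition _ x y := GRing.RMorphism.copy (ev x y)
  (horner_morph (commr_of_comRing (horner_morph (commr_of_comRing iota x)) y)).

Lemma evCC x y c : ev x y c%:P%:P = iota c.
Proof. by rewrite /ev horner_morphC /= horner_morphC. Qed.

Lemma evX x y : ev x y 'X%:P = x.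
Proof. by rewrite /ev horner_morphC /= horner_morphX. Qed.

Lemma evY x y : ev x y 'X = y.
Proof. by rewrite /ev horner_morphX. Qed.

(** A ring morphism out of K[u][v] is pinned down by the constants and the two variables. This
    recognizes as evaluations the substitutions given in another form, such as [swapXY] or a map on
    coefficients. *)
Lemma ev_morph (theta : {rmorphism {poly {poly K}} -> R}) p :
  (forall c, theta c%:P%:P = iota c) ->
  theta p = ev (theta 'X%:P) (theta 'X) p.
Proof.
move=> thetaC; elim/poly_ind: p => [|p q IH]; first by rewrite !rmorph0.
rewrite !rmorphD !rmorphM /= -IH evY; congr (_ + _).
elim/poly_ind: q => [|q c IHq]; first by rewrite !rmorph0.
by rewrite !polyCD !polyCM !rmorphD !rmorphM /= -IHq evX thetaC evCC.
Qed.

End Evaluation.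

Lemma ev_comp (K R R' : comNzRingType) (iota : {rmorphism K -> R})
    (iota' : {rmorphism K -> R'}) (theta : {rmorphism R -> R'}) x y p :
  (forall c, theta (iota c) = iota' c) ->
  theta (ev iota x y p) = ev iota' (theta x) (theta y) p.
Proof.
move=> thetaE; rewrite -[LHS]/((theta \o ev iota x y) p).
rewrite (ev_morph (iota := iota')) /= ?evX ?evY // => c.
by rewrite evCC.
Qed.

Section Bivariate.
Variable K : fieldType.
Implicit Types p q T : {poly {poly K}}.
Local Notation U := ('X%:P : {poly {poly K}}).
Local Notation V := ('X : {poly {poly K}}).

Definition polyCC (c : K) : {poly {poly K}} := c%:P%:P.
HB.instance Definition _ := GRing.RMorphism.copy polyCC (polyC \o polyC).

Lemma polyCC0 : polyCC 0 = 0. Proof. exact: rmorph0. Qed.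
Lemma polyCC1 : polyCC 1 = 1. Proof. exact: rmorph1. Qed.
Lemma polyCCN : {morph polyCC : x / - x}. Proof. exact: rmorphN. Qed.
Lemma polyCCD : {morph polyCC : x y / x + y}. Proof. exact: rmorphD. Qed.
Lemma polyCCB : {morph polyCC : x y / x - y}. Proof. exact: rmorphB. Qed.
Lemma polyCCM : {morph polyCC : x y / x * y}. Proof. exact: rmorphM. Qed.

Definition evb (x y p : {poly {poly K}}) : {poly {poly K}} := ev polyCC x y p.
HB.instance Definition _ x y := GRing.RMorphism.copy (evb x y) (ev polyCC x y).

Lemma evb_id p : evb U V p = p.
Proof. by symmetry; apply: (@ev_morph _ _ polyCC idfun). Qed.

Lemma ev_swapXY (R : comNzRingType) (iota : {rmorphism K -> R}) x y p :
  ev iota x y (swapXY p) = ev iota y x p.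
Proof.
rewrite [LHS](@ev_morph _ _ iota (ev iota x y \o @swapXY K)) /=.
  by rewrite swapXY_X swapXY_Y evX evY.
by move=> c; rewrite swapXY_polyC map_polyC evCC.
Qed.

(** The polynomial auv + bu + cv + d, nested in the shape that [poly_size2] produces. *)
Definition bil (a b c d : K) : {poly {poly K}} :=
  (a%:P * 'X + c%:P)%:P * 'X + (b%:P * 'X + d%:P)%:P.

Lemma ev_bil (R : comNzRingType) (iota : {rmorphism K -> R}) x y a b c d :
  ev iota x y (bil a b c d) =
  iota a * x * y + iota b * x + iota c * y + iota d.
Proof.
rewrite /bil !(polyCD, polyCM) !(rmorphD, rmorphM) /= evX evY !evCC.
by rewrite mulrDl -!addrA; congr (_ + _); rewrite addrCA.
Qed.

Lemma poly_size2 (R : comNzRingType) (p : {poly R}) :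
  (size p <= 2)%N -> p = (p`_1)%:P * 'X + (p`_0)%:P.
Proof.
move=> sp; apply/polyP => -[|[|k]];
  rewrite coefD coefMX !coefC /= ?add0r ?addr0 //.
by rewrite nth_default // (leq_trans sp).
Qed.

(** [size p] bounds the degree in v and [size (swapXY p)] the degree in u, so only four coefficients
    survive. *)
Lemma bil_of_size p : (size p <= 2)%N -> (size (swapXY p) <= 2)%N ->
  exists a b c d, p = bil a b c d.
Proof.
move=> sp st; have sc j : (size (p`_j)%R <= 2)%N.
  apply/leq_sizeP => k k2.
  rewrite -coef_swapXY [(swapXY p)`_k]nth_default ?coef0 //.
  exact: leq_trans st k2.
rewrite (poly_size2 sp) (poly_size2 (sc 0%N)) (poly_size2 (sc 1%N)).
by do 4!eexists.
Qed.

End Bivariate.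

(** * Solutions of the polynomial identities *)

Section Classification.
Variable K : fieldType.
Implicit Types p q T M N : {poly {poly K}}.
Local Notation U := ('X%:P : {poly {poly K}}).
Local Notation V := ('X : {poly {poly K}}).

(** Comes from the coefficient of the first transposition in the braid relation once neighbours
    share T. Letting x, y, z be arbitrary polynomials keeps every specialization available. *)
Definition yang_baxter T := forall x y z,
  evb x y T * evb y z T * (x - z) - evb x z T * evb y x T * (y - z)
  = evb y z T * evb x z T * (x - y).

Lemma yang_baxter_size T : yang_baxter T -> (size T <= 2)%N.
Proof.
move=> YB; have [->|T0] := eqVneq T 0; first by rewrite size_poly0.
(* At x = 'X%:P, y = ('X^2)%:P, z = 'X the right-hand side has degree
   2 deg T in z, the left-hand side at most deg T + 1. *)
pose w : {poly K} := 'X^2.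
have := YB U w%:P V; rewrite evb_id.
pose c a a' := ev polyC a a' T.
have evE a a' : evb a%:P a'%:P T = (c a a')%:P.
  symmetry.
  by apply: (@ev_comp K {poly K} {poly {poly K}} polyC (@polyCC K) polyC).
have thV : map_poly (comp_poly w) V = V by apply: map_polyX.
have thU : map_poly (comp_poly w) U = w%:P.
  by rewrite (map_polyC (comp_poly w)) /= comp_polyX.
have thC k : map_poly (comp_poly w) k%:P%:P = k%:P%:P.
  by rewrite (map_polyC (comp_poly w)) /= comp_polyC.
(* Evaluating at ('X^2, v) substitutes 'X^2 into each coefficient. As 'X^2 is not constant, the
   leading coefficient survives and the degree in v is kept. *)
have -> : evb w%:P V T = map_poly (comp_poly w) T.
  rewrite -(congr2 (fun a b => evb a b T) thU thV); symmetry.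
  pose th : {rmorphism {poly {poly K}} -> {poly {poly K}}} :=
    map_poly (comp_poly w).
  exact: (@ev_morph K _ (@polyCC K) th T thC).
rewrite !evE -polyCB.
set p := map_poly _ T.
have sX2 : (1 < size w)%N by rewrite size_polyXn.
have sp : size p = size T.
  by rewrite size_map_poly_id0 //= comp_poly_eq0 // lead_coef_eq0.
have p0 : p != 0 by rewrite -size_poly_eq0 sp size_poly_eq0.
have sC a q : (size (a%:P * q)%R <= size q)%N.
  by rewrite mul_polyC size_scale_leq.
have sL (a : {poly K}) q : (size (q * (a%:P - 'X))%R <= (size q).+1)%N.
  rewrite (leq_trans (size_polyMleq _ _)) // -opprB size_polyN size_XsubC.
  by rewrite addn2.
(* The factor x - y is free of z and nonzero, so it does not change the degree of the right-hand
   side. *)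
have X0 : 'X - w != 0.
  rewrite subr_eq0; apply/eqP => /(congr1 (fun p : {poly K} => size p)).
  by rewrite size_polyX size_polyXn.
move=> /(congr1 (fun p : {poly {poly K}} => size p)).
have -> : size (p * T * ('X - w)%:P) = (size T + size T).-1.
  by rewrite mulrC mul_polyC size_scale // size_mul // sp.
move=> E.
have : ((size T + size T).-1 <= (size T).+1)%N.
  rewrite -E (leq_trans (size_polyD _ _)) // geq_max; apply/andP; split.
    by rewrite (leq_trans (sL _ _)) // ltnS (leq_trans (sC _ _)) ?sp.
  rewrite size_polyN (leq_trans (sL _ _)) // ltnS mulrC.
  exact: sC.
lia.
Qed.

(** Source of the condition ad = bc: on a bilinear T the defect of the Yang-Baxter identity is the
    determinant times a Vandermonde product. *)
Lemma bil_yang_baxter (R : comNzRingType) (a b c d x y z : R) :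
  let t u v := a * u * v + b * u + c * v + d in
  t x y * t y z * (x - z) - t x z * t y x * (y - z) - t y z * t x z * (x - y)
  = (a * d - b * c) * ((x - y) * (y - z) * (x - z)).
Proof. by rewrite /=; ring. Qed.

Lemma polyCC_eq0 (c : K) : (polyCC c == 0) = (c == 0).
Proof. by rewrite /polyCC !polyC_eq0. Qed.

Lemma polyU_neq0 : U != 0. Proof. by rewrite polyC_eq0 polyX_eq0. Qed.
Lemma polyV_neq0 : V != 0. Proof. by rewrite polyX_eq0. Qed.
Lemma polyUV_neq0 : U - V != 0.
Proof. by rewrite -opprB oppr_eq0 polyXsubC_eq0. Qed.

Lemma yang_baxter_bil T : yang_baxter T -> yang_baxter (swapXY T) ->
  exists a b c d, T = bil a b c d /\ a * d - b * c = 0.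
Proof.
move=> YB YB'.
have [a [b [c [d ET]]]] :=
  bil_of_size (yang_baxter_size YB) (yang_baxter_size YB').
exists a, b, c, d; split=> //; apply/eqP.
(* At (u, v, 0) the Vandermonde product is (u - v)vu, which is nonzero and can be cancelled. *)
have := YB U V 0; rewrite ET /evb !ev_bil => /eqP.
rewrite -subr_eq0 (bil_yang_baxter (polyCC a) (polyCC b) (polyCC c) (polyCC d)).
rewrite -!rmorphM -rmorphB /= !subr0 !mulf_eq0 (negPf polyUV_neq0).
rewrite (negPf polyU_neq0) (negPf polyV_neq0) !orbF.
by rewrite polyCC_eq0.
Qed.

(** A 2 by 2 matrix of determinant 0 is a column times a row; this splits T as (al u + be)(ga v +
    de). *)
Lemma rank1_factor (a b c d : K) : a * d - b * c = 0 ->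
  exists al be ga de, [/\ a = al * ga, b = al * de, c = be * ga & d = be * de].
Proof.
move=> /eqP; rewrite subr_eq0 => /eqP E.
have [a0|a0] := eqVneq a 0.
  have [b0|b0] := eqVneq b 0.
    by exists 0, 1, c, d; rewrite a0 b0 !mul0r !mul1r.
  have c0 : c = 0.
    by move/esym/eqP: E; rewrite a0 mul0r mulf_eq0 (negPf b0) => /eqP.
  by exists b, d, 0, 1; rewrite a0 c0 !mulr0 !mulr1.
exists 1, (c / a), a, b; split; rewrite ?mul1r ?divfK //.
by rewrite mulrAC [c * b]mulrC -E [a * d]mulrC mulfK.
Qed.

Lemma evb_swapXY x y p : evb x y (swapXY p) = evb y x p.
Proof. exact: ev_swapXY. Qed.

Lemma evbU x y : evb x y U = x. Proof. exact: evX. Qed.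
Lemma evbV x y : evb x y V = y. Proof. exact: evY. Qed.

Lemma evbCC (x y : {poly {poly K}}) (c : K) : evb x y (polyCC c) = polyCC c.
Proof. exact: evCC. Qed.
Lemma evbD (x y : {poly {poly K}}) : {morph evb x y : p q / p + q}.
Proof. exact: rmorphD. Qed.
Lemma evbB (x y : {poly {poly K}}) : {morph evb x y : p q / p - q}.
Proof. exact: rmorphB. Qed.
Lemma evbM (x y : {poly {poly K}}) : {morph evb x y : p q / p * q}.
Proof. exact: rmorphM. Qed.

Lemma evb_const c c' p :
  evb (polyCC c) (polyCC c') p = polyCC (ev idfun c c' p).
Proof.
symmetry.
by apply: (@ev_comp K K {poly {poly K}} idfun (@polyCC K) (@polyCC K)).
Qed.

Lemma swapXY_norm_diff p q :
  swapXY (p * swapXY p - q * swapXY q) = p * swapXY p - q * swapXY q.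
Proof.
by rewrite rmorphB !rmorphM /= !swapXYK; congr (_ - _); apply: mulrC.
Qed.

(** For z = y + 1 the hypothesis reads p(x,y) = (x - y)^2 g(y) with g(y) = q(y, y + 1). Symmetry of
    p forces g(x) = g(0) for x nonzero, so g is the constant kappa. Applied to T T' - M M', where
    the prime exchanges u and v, it gives neighbours a common kappa. *)
Lemma symmetric_square_cocycle (p q : {poly {poly K}}) : swapXY p = p ->
  (forall x y z, (y - z) ^+ 2 * evb x y p = (x - y) ^+ 2 * evb y z q) ->
  exists kappa : K, p = polyCC kappa * (U - V) ^+ 2 /\
                    q = polyCC kappa * (U - V) ^+ 2.
Proof.
move=> sp E.
(* Put z = y + 1. *)
have pE x y : evb x y p = (x - y) ^+ 2 * evb y (y + 1) q.
  by rewrite -E opprD addrA subrr sub0r sqrrN expr1n mul1r.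
have pC x y : evb x y p = evb y x p by rewrite -evb_swapXY sp.
have constq x : x != 0 -> evb x (x + 1) q = evb 0 (0 + 1) q.
  move=> x0; apply: (mulfI (_ : (x - 0) ^+ 2 != 0)).
    by rewrite subr0 expf_neq0.
  by rewrite -pE pC pE -sqrrN opprB.
pose kappa : K := ev idfun 0 1 q.
have qE : evb 0 (0 + 1) q = polyCC kappa.
  by rewrite add0r -evb_const rmorph0 rmorph1.
exists kappa; split.
  by rewrite -[LHS]evb_id pE constq ?polyV_neq0 // qE mulrC.
(* For q take (x, y, z) = (0, u, v), where p(0, u) = kappa u^2, and cancel u^2. *)
apply: (mulfI (_ : U ^+ 2 != 0)); first by rewrite expf_neq0 // polyU_neq0.
have := E 0 U V; rewrite evb_id sub0r sqrrN => <-.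
by rewrite pE constq ?polyU_neq0 // qE sub0r sqrrN; ring.
Qed.

(** * Splitting a norm into linear factors *)

Definition linU (al be : K) : {poly {poly K}} := polyCC al * U + polyCC be.
Definition linV (al be : K) : {poly {poly K}} := polyCC al * V + polyCC be.

Lemma swapXY_CC c : swapXY (polyCC c) = polyCC c :> {poly {poly K}}.
Proof. by rewrite /polyCC swapXY_polyC map_polyC. Qed.

Lemma swapXY_linU al be : swapXY (linU al be) = linV al be.
Proof. by rewrite rmorphD rmorphM /= !swapXY_CC swapXY_Y. Qed.

Lemma swapXY_linV al be : swapXY (linV al be) = linU al be.
Proof. by rewrite -swapXY_linU swapXYK. Qed.

Lemma linU_neq0 al be : (al != 0) || (be != 0) -> linU al be != 0.
Proof.
move=> nz; have -> : linU al be = (al%:P * 'X + be%:P)%:P.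
  by rewrite polyCD polyCM.
rewrite polyC_eq0; apply/eqP => /polyP E; case/orP: nz => /eqP; apply.
  by have := E 1%N; rewrite coefD coefMX !coefC addr0.
by have := E 0%N; rewrite coefD coefMX !coefC add0r.
Qed.

Lemma linV_neq0 al be : (al != 0) || (be != 0) -> linV al be != 0.
Proof. by move=> nz; rewrite -swapXY_linU swapXY_eq0 linU_neq0. Qed.

(** A linear factor al v + be is prime or a nonzero constant, so it divides M or [swapXY M]; in the
    second case al u + be divides M. The cofactor inherits the norm equation with the pair of
    factors removed. *)
Lemma linear_factor al be M N : (al != 0) || (be != 0) ->
  M * swapXY M = linU al be * linV al be * N ->
  exists M1, M1 * swapXY M1 = N /\
    (M = linU al be * M1 \/ M = linV al be * M1).
Proof.
move=> nz E.
suff [M1 EM1] : exists M1, M = linU al be * M1 \/ M = linV al be * M1.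
  exists M1; split=> //.
  apply: (mulfI (mulf_neq0 (linU_neq0 nz) (linV_neq0 nz))); rewrite -E.
  by case: EM1 => ->; rewrite rmorphM /= ?swapXY_linU ?swapXY_linV; ring.
have [al0|al0] := eqVneq al 0.
  exists (polyCC be^-1 * M); left.
  rewrite /linU al0 polyCC0 mul0r add0r mulrA -polyCCM divff ?polyCC1 ?mul1r //.
  by move: nz; rewrite al0 eqxx.
(* The root of al v + be: since K[u] is a domain, a root of the product is a root of M or of
   [swapXY M]. *)
pose r := (- (be / al))%:P : {poly K}.
have fact p : root p r -> exists q, p = linV al be * q.
  case/factor_theorem=> q ->; exists (polyCC al^-1 * q).
  have -> : linV al be = polyCC al * ('X - r%:P).
    by rewrite /linV mulrBr -polyCCM mulrN mulrCA divff // mulr1 polyCCN opprK.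
  have AB : polyCC al * polyCC al^-1 = 1 by rewrite -polyCCM divff // polyCC1.
  by rewrite -[LHS]mulr1 -AB; ring.
have : root (M * swapXY M) r.
  have linV_r : (linV al be).[r] = 0.
    rewrite /linV hornerD (hornerM (polyCC al) V r) hornerX /polyCC !hornerC.
    by rewrite -polyCM mulrN mulrCA divff // mulr1 polyCN addNr.
  by rewrite E; apply/eqP; rewrite !hornerM linV_r mulr0 mul0r.
rewrite rootM => /orP[/fact [q Eq]|/fact [q Eq]].
  by exists q; right.
by exists (swapXY q); left; rewrite -[M]swapXYK Eq rmorphM /= swapXY_linV.
Qed.

Lemma norm1_const M : M * swapXY M = 1 -> exists c, M = polyCC c.
Proof.
move=> E; have : M \is a GRing.unit.
  by apply/unitrP; exists (swapXY M); rewrite mulrC.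
rewrite poly_unitE => /andP[/eqP s1]; rewrite poly_unitE => /andP[/eqP s2 _].
exists ((M`_0)`_0); rewrite /polyCC -size1_polyC ?s2 //.
by rewrite -size1_polyC ?s1.
Qed.

(** [linear_factor] strips one factor from each of the two pairs; the remainder has norm 1, hence is
    a constant. All four products agree on the diagonal, and comparison with T there makes this
    constant 1. *)
Lemma split_norm al be ga de M (T := linU al be * linV ga de) : T != 0 ->
  M * swapXY M = T * swapXY T -> evb U U M = evb U U T ->
  [\/ M = linU al be * linV ga de, M = linV al be * linU ga de,
      M = linU al be * linU ga de | M = linV al be * linV ga de].
Proof.
move=> T0 E D.
have nz1 : (al != 0) || (be != 0).
  apply: contraNT T0; rewrite /T negb_or !negbK => /andP[/eqP-> /eqP->].
  by rewrite /linU !polyCC0 mul0r add0r mul0r.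
have nz2 : (ga != 0) || (de != 0).
  apply: contraNT T0; rewrite /T negb_or !negbK => /andP[/eqP-> /eqP->].
  by rewrite /linV !polyCC0 mul0r add0r mulr0.
have [M1 [E1 EM]] : exists M1, M1 * swapXY M1 = linU ga de * linV ga de * 1 /\
    (M = linU al be * M1 \/ M = linV al be * M1).
  apply: linear_factor => //.
  by rewrite E /T rmorphM /= swapXY_linU swapXY_linV; ring.
have [M2 [E2 EM1]] := linear_factor nz2 E1.
have [c Ec] := norm1_const E2.
have evL a b : evb U U (linU a b) = linU a b /\ evb U U (linV a b) = linU a b.
  by rewrite /linU /linV !evbD !evbM evbU evbV !evbCC.
have c1 : M2 = 1.
  apply: (mulfI (mulf_neq0 (linU_neq0 nz1) (linU_neq0 nz2))).
  have evM2 : evb U U M2 = M2 by rewrite Ec evbCC.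
  have <- : evb U U M = linU al be * linU ga de * M2.
    by case: EM => ->; case: EM1 => ->;
      rewrite !evbM evM2 ?(evL _ _).1 ?(evL _ _).2 mulrA.
  by rewrite D /T evbM (evL _ _).1 (evL _ _).2 mulr1.
move: EM EM1; rewrite c1 !mulr1 => -[->|->] [->|->].
- exact: Or43.
- exact: Or41.
- exact: Or42.
- exact: Or44.
Qed.

Lemma bilE (a b c d : K) :
  bil a b c d = polyCC a * U * V + polyCC b * U + polyCC c * V + polyCC d.
Proof.
by rewrite /bil !polyCD !polyCM /polyCC; ring.
Qed.

Lemma swapXY_bil (a b c d : K) : swapXY (bil a b c d) = bil a c b d.
Proof.
rewrite !bilE !rmorphD !rmorphM /= !swapXY_CC swapXY_X swapXY_Y; ring.
Qed.

(** * Bilinear polynomials: diagonal and norm *)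

Definition quadX (R : nzRingType) (a b c : R) : {poly R} :=
  a%:P * 'X ^+ 2 + b%:P * 'X + c%:P.

Lemma quadX2 (R : nzRingType) (a b c : R) : (quadX a b c)`_2 = a.
Proof.
by rewrite !coefD !coefCM coefXn coefX coefC !mulr0 mulr1 !addr0.
Qed.

Lemma quadX1 (R : nzRingType) (a b c : R) : (quadX a b c)`_1 = b.
Proof.
by rewrite !coefD !coefCM coefXn coefX coefC !mulr0 mulr1 add0r addr0.
Qed.

Lemma quadX0 (R : nzRingType) (a b c : R) : (quadX a b c)`_0 = c.
Proof. by rewrite !coefD !coefCM coefXn coefX coefC !mulr0 !add0r. Qed.

Lemma size_quadX (R : nzRingType) (a b c : R) : (size (quadX a b c) <= 3)%N.
Proof.
apply/leq_sizeP => -[|[|[|k]]] // _.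
by rewrite !coefD !coefCM coefXn coefX coefC !mulr0 !add0r.
Qed.

Lemma bil_diag (a b c d : K) :
  evb U U (bil a b c d) = (quadX a (b + c) d)%:P.
Proof.
rewrite bilE !evbD !evbM evbU evbV !evbCC /quadX !polyCD !polyCM /polyCC.
by rewrite ?polyC_exp; ring.
Qed.

(** With t(u) the diagonal value at (u, u), the first summand is t(u) t(v); for ad = bc the norm is
    thus determined by the diagonal. *)
Lemma bil_norm (a b c d : K) :
  bil a b c d * swapXY (bil a b c d) =
  (quadX a (b + c) d)%:P * quadX a%:P (b + c)%:P d%:P +
  polyCC (b * c - a * d) * (U - V) ^+ 2.
Proof.
rewrite swapXY_bil !bilE /quadX !(polyCCB, polyCCM) !(polyCD, polyCM) /polyCC.
by rewrite ?polyC_exp; ring.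
Qed.

Lemma evbUU_polyC (m : {poly K}) : evb U U m%:P = m%:P.
Proof.
elim/poly_ind: m => [|m c IH].
  by rewrite -[LHS]/(evb _ _ (polyCC 0)) evbCC.
by rewrite polyCD polyCM evbD evbM IH evbU -/(polyCC c) evbCC.
Qed.

(* The degrees of M in u and v add up to 2; if M depended on one variable only,
   the diagonal would determine it and force kappa = 0. *)
Lemma bil_of_norm (a b c d kappa : K) M : a * d - b * c = 0 -> kappa != 0 ->
  bil a b c d * swapXY (bil a b c d) - M * swapXY M
    = polyCC kappa * (U - V) ^+ 2 ->
  evb U U M = evb U U (bil a b c d) ->
  exists e, M = bil a (c + e) (b - e) d.
Proof.
move=> rk1 k0; have rk1' : b * c - a * d = 0 by rewrite -opprB rk1 oppr0.
rewrite bil_norm bil_diag rk1' polyCC0 mul0r addr0.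
set t := quadX a (b + c) d => E D.
pose A := a%:P * t - kappa%:P.
(* The norm of M as a quadratic in v over K[u], with leading coefficient [A]. *)
have EW : M * swapXY M =
    quadX A ((b + c)%:P * t + (kappa%:P * 'X + kappa%:P * 'X))
            (d%:P * t - kappa%:P * 'X ^+ 2).
  have -> : M * swapXY M = t%:P * quadX a%:P (b + c)%:P d%:P
      - polyCC kappa * (U - V) ^+ 2 by rewrite -E subKr.
  rewrite /quadX /A !(polyCB, polyCD, polyCM) /polyCC ?polyC_exp.
  by ring.
(* The coefficient of u^2 in [A] is a^2; if it vanishes, [A] is the nonzero constant -kappa. *)
have A0 : A != 0.
  apply: contraNneq k0 => A0.
  have a0 : a = 0.
    have := congr1 (fun p : {poly K} => p`_2) A0.
    rewrite /A coefB coefCM quadX2 coefC subr0 coef0 => /eqP.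
    by rewrite mulf_eq0 orbb => /eqP.
  by have /eqP := A0; rewrite /A a0 mul0r sub0r oppr_eq0 polyC_eq0.
have sW : size (M * swapXY M) = 3.
  apply/eqP; rewrite eqn_leq EW size_quadX ltnNge; apply: contraNN A0 => s2.
  by rewrite -[A](quadX2 A ((b + c)%:P * t + (kappa%:P * 'X + kappa%:P * 'X))
    (d%:P * t - kappa%:P * 'X ^+ 2)) nth_default.
have M0 : M != 0 by apply: contra_eq_neq sW => ->; rewrite mul0r size_poly0.
have M0' : swapXY M != 0 by rewrite swapXY_eq0.
(* If M depended on u or v alone it would be t(u) or t(v), its norm would be t(u) t(v) as for T, and
   kappa would vanish. *)
have no_univariate m : m%:P = t%:P -> m%:P * swapXY m%:P != M * swapXY M.
  move=> ->; apply/eqP => E'.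
  have swt : swapXY t%:P = quadX a%:P (b + c)%:P d%:P.
    rewrite swapXY_polyC /t /quadX !rmorphD !rmorphM /= !map_polyC.
    by rewrite !map_polyX rmorphD /= !map_polyC.
  move: E; rewrite -E' swt subrr => /esym/eqP.
  rewrite mulf_eq0 expf_eq0 (negPf polyUV_neq0) andbF orbF polyCC_eq0.
  by rewrite (negPf k0).
have : (size M <= 2)%N && (size (swapXY M) <= 2)%N.
  (* The degree 2 of the norm in v is the sum of the degrees of M in v and in u; neither being 0,
     both are 1. *)
  have sW' : (size M + size (swapXY M)).-1 = 3 by rewrite -size_mul.
  have [s1|s1] := leqP (size M) 1.
    have EM := size1_polyC s1.
    have D' : (M`_0)%:P = t%:P by rewrite -D -[LHS]evbUU_polyC -EM.
    by have := no_univariate _ D'; rewrite -EM eqxx.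
  have [s2|s2] := leqP (size (swapXY M)) 1.
    have EM := size1_polyC s2.
    have D' : ((swapXY M)`_0)%:P = t%:P.
      by rewrite -D -evb_swapXY -[LHS]evbUU_polyC -EM.
    by have := no_univariate _ D'; rewrite -EM swapXYK mulrC eqxx.
  by apply/andP; split; lia.
case/andP=> s1 s2.
have [a' [b' [c' [d' EM]]]] := bil_of_size s1 s2.
move: D; rewrite EM bil_diag => /polyC_inj D.
have [Da Db Dd] : [/\ a' = a, b' + c' = b + c & d' = d].
  split; first by rewrite -(quadX2 a' (b' + c') d') D quadX2.
    by rewrite -(quadX1 a' (b' + c') d') D quadX1.
  by rewrite -(quadX0 a' (b' + c') d') D quadX0.
exists (b' - c); rewrite Da Dd; congr bil; first by rewrite addrC subrK.
by rewrite opprB addrA -Db addrAC subrr add0r.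
Qed.

Lemma evb_bil x y (a b c d : K) : evb x y (bil a b c d) =
  polyCC a * x * y + polyCC b * x + polyCC c * y + polyCC d.
Proof. exact: ev_bil. Qed.

Lemma polyCC_inj : injective (@polyCC K).
Proof. by move=> x y /polyC_inj /polyC_inj. Qed.

(** Both polynomials have the same diagonal, so by [bil_norm] only bc - (c + e)(b - e) = e (e - (b -
    c)) remains. *)
Lemma bil_norm_shift (a b c d e : K) :
  bil a b c d * swapXY (bil a b c d) -
  bil a (c + e) (b - e) d * swapXY (bil a (c + e) (b - e) d) =
  polyCC (e * (e - (b - c))) * (U - V) ^+ 2.
Proof.
rewrite !swapXY_bil !bilE !(polyCCM, polyCCB, polyCCD); ring.
Qed.

(** If e and e' differ, then e' = b - c - e, which exchanges the middle coefficients p = c + e and q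
    = b - e: N is M with u and v swapped. At z = 0 the defect of the cubic relation is then (pq -
    ad)(p - q)(u - v)uv, and pq - ad = -e (e - (b - c)) is nonzero. So p = q, whence e = e'. *)
Lemma bil_braid_unique (a b c d e e' : K)
    (M := bil a (c + e) (b - e) d) (N := bil a (c + e') (b - e') d) :
  a * d - b * c = 0 ->
  e * (e - (b - c)) != 0 -> e * (e - (b - c)) = e' * (e' - (b - c)) ->
  (forall x y z,
    evb x y M * evb x z N * evb y z M = evb y z N * evb x z M * evb x y N) ->
  e = e'.
Proof.
move=> rk1 nz E braid; apply/eqP; rewrite -subr_eq0.
have : (e - e') * (e + e' - (b - c)) == 0.
  apply/eqP; transitivity (e * (e - (b - c)) - e' * (e' - (b - c))).
    by ring.
  by rewrite E subrr.
rewrite mulf_eq0 => /orP[//|/eqP E'].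
have e'E : e' = b - c - e.
  by rewrite -[RHS]add0r -E'; ring.
have Ep : b - e' = c + e by rewrite e'E; ring.
have Eq : c + e' = b - e by rewrite e'E; ring.
have := braid U V 0; rewrite /M /N Ep Eq !evb_bil => /eqP; rewrite -subr_eq0.
set L := (X in X == 0).
have -> : L = polyCC (((c + e) * (b - e) - a * d) * ((c + e) - (b - e))) *
              ((U - V) * (V - 0) * (U - 0)).
  rewrite /L; move: (c + e) (b - e) => p q.
  by rewrite polyCCM !polyCCB !polyCCM; ring.
rewrite !subr0 !mulf_eq0 (negPf polyUV_neq0) (negPf polyU_neq0).
rewrite (negPf polyV_neq0) !orbF polyCC_eq0 mulf_eq0 => /orP[|/eqP pq].
  have -> : (c + e) * (b - e) - a * d = - (e * (e - (b - c))) - (a * d - b * c).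
    by ring.
  by rewrite rk1 subr0 oppr_eq0 (negPf nz).
by rewrite e'E -pq; apply/eqP; ring.
Qed.

End Classification.

(** * Divided difference operators *)

Section Operators.
Variables (K : fieldType) (n : nat).
Local Notation U := ('X%:P : {poly {poly K}}).
Local Notation V := ('X : {poly {poly K}}).
Implicit Types (x y f g h : {mpoly K[n]}) (p q : {poly {poly K}}).
Implicit Types P Q R S : {mpoly K[2]}.

Definition evm x y p : {mpoly K[n]} := ev (@mpolyC n K) x y p.
HB.instance Definition _ x y :=
  GRing.RMorphism.copy (evm x y) (ev (@mpolyC n K) x y).

Lemma evmU x y : evm x y U = x. Proof. exact: evX. Qed.
Lemma evmV x y : evm x y V = y. Proof. exact: evY. Qed.
Lemma evmCC x y (c : K) : evm x y (polyCC c) = c%:MP. Proof. exact: evCC. Qed.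
Lemma evmD x y : {morph evm x y : p q / p + q}.
Proof. exact: rmorphD. Qed.
Lemma evmB x y : {morph evm x y : p q / p - q}.
Proof. exact: rmorphB. Qed.
Lemma evmM x y : {morph evm x y : p q / p * q}.
Proof. exact: rmorphM. Qed.
Lemma evm_bil x y (a b c d : K) : evm x y (bil a b c d) =
  a%:MP * x * y + b%:MP * x + c%:MP * y + d%:MP.
Proof. exact: ev_bil. Qed.

Lemma ev2D P Q x y : ev2 (P + Q) x y = ev2 P x y + ev2 Q x y.
Proof. exact: comp_mpolyD. Qed.
Lemma ev2B P Q x y : ev2 (P - Q) x y = ev2 P x y - ev2 Q x y.
Proof. exact: comp_mpolyB. Qed.
Lemma ev2M P Q x y : ev2 (P * Q) x y = ev2 P x y * ev2 Q x y.
Proof. exact: rmorphM. Qed.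
Lemma ev2Z (c : K) P x y : ev2 (c *: P) x y = c%:MP * ev2 P x y.
Proof. by rewrite /ev2 comp_mpolyZ mul_mpolyC. Qed.
Lemma ev2C (c : K) x y : ev2 c%:MP x y = c%:MP.
Proof. exact: comp_mpolyC. Qed.
Lemma ev2_0 x y : ev2 0 x y = 0.
Proof. exact: comp_mpoly0. Qed.
Lemma ev2u x y : ev2 (varu K) x y = x.
Proof. exact: comp_mpolyXU. Qed.
Lemma ev2v x y : ev2 (varv K) x y = y.
Proof. exact: comp_mpolyXU. Qed.

Lemma msymC (s : 'S_n) (c : K) : msym s c%:MP = c%:MP.
Proof.
have -> : c%:MP = c *: 1 :> {mpoly K[n]} by rewrite -mul_mpolyC mulr1.
by rewrite msymZ msym1.
Qed.

Lemma msym_evm s x y p : msym s (evm x y p) = evm (msym s x) (msym s y) p.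
Proof.
apply: (@ev_comp K {mpoly K[n]} {mpoly K[n]} (@mpolyC n K) (@mpolyC n K)
                 (msym s)).
by move=> c; apply: msymC.
Qed.

Lemma swap_evm i x y p : swap i (evm x y p) = evm (swap i x) (swap i y) p.
Proof. exact: msym_evm. Qed.

End Operators.

(** * From [{mpoly K[2]}] to nested polynomials *)

Section BivariateConversion.
Variable K : fieldType.
Implicit Types P Q R S : {mpoly K[2]}.
Local Notation U := ('X%:P : {poly {poly K}}).
Local Notation V := ('X : {poly {poly K}}).

(** Gives access to degrees in a single variable, [swapXY] and the factor theorem. *)
Definition bipoly P : {poly {poly K}} :=
  mmap (@polyCC K) (fun i : 'I_2 => if i == ord0 then U else V) P.

Lemma evm_bipoly n (x y : {mpoly K[n]}) P : evm x y (bipoly P) = ev2 P x y.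
Proof.
rewrite /bipoly /ev2 /comp_mpoly /mmap.
rewrite [LHS](raddf_sum (evm x y)); apply: eq_bigr => m _.
rewrite [LHS](rmorphM (evm x y)) /= evmCC.
congr (_ * _); rewrite /mmap1 !big_ord_recl !big_ord0 !mulr1.
by rewrite [LHS](rmorphM (evm x y)) !(rmorphXn (evm x y)) /= evmU evmV.
Qed.

Lemma ev2_ev2 n P (g h : {mpoly K[2]}) (x y : {mpoly K[n]}) :
  ev2 (ev2 P g h) x y = ev2 P (ev2 g x y) (ev2 h x y).
Proof.
pose th : {rmorphism {mpoly K[2]} -> {mpoly K[n]}} := comp_mpoly [tuple x; y].
rewrite -(evm_bipoly g h P) -(evm_bipoly _ _ P).
apply: (@ev_comp K {mpoly K[2]} {mpoly K[n]} (@mpolyC 2 K) (@mpolyC n K) th).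
by move=> c; apply: ev2C.
Qed.

End BivariateConversion.

Section OneOperator.
Variables (K : fieldType) (n : nat) (i : 'I_n.-1).
Implicit Types P Q R S : {mpoly K[2]}.
Implicit Types (x y f g h : {mpoly K[n]}) (p q T M : {poly {poly K}}).
Local Notation x := (xlo K i).
Local Notation y := (xhi K i).

Lemma swap_lo : swap i x = y. Proof. by rewrite swapX tpermL. Qed.
Lemma swap_hi : swap i y = x. Proof. by rewrite swapX tpermR. Qed.

Lemma mpolyXm_inj m : injective (fun u : 'X_{1..m} => 'X_[u] : {mpoly K[m]}).
Proof.
move=> u v /(congr1 (mcoeff u)); rewrite !mcoeffX eqxx.
by case: eqP => // _ /eqP; rewrite oner_eq0.
Qed.

Lemma mpolyX_inj m : injective (fun j : 'I_m => 'X_j : {mpoly K[m]}).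
Proof.
move=> j k /mpolyXm_inj/(congr1 (fun u : 'X_{1..m} => u j)).
by rewrite !mnm1E eqxx; case: eqP => // -> _.
Qed.

Lemma subX_neq0 m (j k : 'I_m) : j != k -> 'X_j - 'X_k != 0 :> {mpoly K[m]}.
Proof. by rewrite subr_eq0 (inj_eq (@mpolyX_inj m)). Qed.

Lemma swapB : {morph @swap K n i : f g / f - g}. Proof. exact: msymB. Qed.
Lemma swapM : {morph @swap K n i : f g / f * g}. Proof. exact: msymM. Qed.

Lemma swapK f : swap i (swap i f) = f.
Proof. by rewrite /swap -msymMm tperm2 msym1m. Qed.

(** The form (x_i - x_{i+1})^-1 (T - M s_i) of the operator, without the denominator; M stands for
    Q_0. *)
Definition acts T M (pi : {mpoly K[n]} -> {mpoly K[n]}) := forall f,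
  (x - y) * pi f = evm x y T * f - evm x y M * swap i f.

Lemma pddo_mul P Q R S f : (x - y) * pddo i P Q R S f =
  (ev2 P x y + (x - y) * ev2 R x y + ev2 Q x y) * f -
  (ev2 P y x + ev2 Q x y - (x - y) * ev2 S x y) * swap i f.
Proof.
rewrite /pddo !mulrDr ddiffE swapM.
have -> : swap i (ev2 P x y) = ev2 P y x.
  by rewrite -!evm_bipoly swap_evm swap_lo swap_hi.
have -> : (x - y) * (ev2 Q x y * ddiff i f) = ev2 Q x y * (f - swap i f).
  by rewrite -ddiffE mulrCA.
move: (ev2 P x y) (ev2 P y x) (ev2 Q x y) (ev2 R x y) (ev2 S x y) (swap i f).
by move: (x) (y) => X Y p p' q r s g; ring.
Qed.

(** T and M determine the operator because x_i - x_{i+1} cancels; recognizing a presentation thus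
    takes two polynomial identities. *)
Lemma acts_presentation T M pi P Q R :
  ev2 P x y + (x - y) * ev2 R x y + ev2 Q x y = evm x y T ->
  ev2 P y x + ev2 Q x y = evm x y M ->
  acts T M pi <-> (forall f, pi f = pddo i P Q R 0 f).
Proof.
move=> ET EM.
have E f : (x - y) * pddo i P Q R 0 f = evm x y T * f - evm x y M * swap i f.
  by rewrite pddo_mul ET ev2_0 mulr0 subr0 EM.
split=> [A f|A f]; last by rewrite A E.
by apply: (mulfI (subX_neq0 (lo_neq_hi i))); rewrite [LHS]A E.
Qed.

Lemma acts_pddo P Q R S :
  acts (bipoly (polyT P Q R)) (bipoly (polyQ0 P Q S)) (pddo i P Q R S).
Proof.
move=> f; rewrite pddo_mul !evm_bipoly /polyT /polyQ0 !(ev2B, ev2D, ev2M).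
rewrite ev2_ev2 !ev2u !ev2v.
move: (ev2 P x y) (ev2 P y x) (ev2 Q x y) (ev2 R x y) (ev2 S x y) (swap i f).
by move: (x) (y) => X Y p p' q r s g; ring.
Qed.

End OneOperator.

(** * Linear independence of the permutations *)

(** By linearity the weighted sum vanishes for every polynomial in place of a power; the product of
    X - a_j over j other than i isolates c_i. *)
Lemma power_sums_eq0 (R : idomainType) (N : nat) (c a : 'I_N -> R) :
  injective a -> (forall m, \sum_(i < N) c i * a i ^+ m = 0) ->
  forall i, c i = 0.
Proof.
move=> inj_a E i; pose p := \prod_(j | j != i) ('X - (a j)%:P).
have : \sum_(k < N) c k * p.[a k] = 0.
  under eq_bigr do rewrite horner_coef mulr_sumr.
  rewrite exchange_big big1 //= => l _.
  under eq_bigr do rewrite mulrCA.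
  by rewrite -mulr_sumr E mulr0.
rewrite (bigD1 i) //= big1 => [|k ki].
  rewrite addr0 => /eqP; rewrite mulf_eq0 horner_prod => /orP[/eqP //|].
  rewrite prodf_seq_eq0 => /hasP[j _ /andP[ji]].
  by rewrite hornerXsubC subr_eq0 (inj_eq inj_a) eq_sym (negPf ji).
by rewrite horner_prod (bigD1 k) //= hornerXsubC subrr mul0r mulr0.
Qed.

Section Braid.
Variables (K : fieldType) (n : nat) (i j : 'I_n.-1).
Hypothesis adj : j = i.+1 :> nat.
Local Notation F := {fraction {mpoly K[n]}}.
Local Notation tau := (@tofrac {mpoly K[n]}).
Local Notation a := (lo i).
Local Notation b := (hi i).
Local Notation c := (hi j).
Local Notation s1 := (@swap K n i).
Local Notation s2 := (@swap K n j).

Lemma hi_lo : hi i = lo j.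
Proof. by apply: val_inj; rewrite /= adj. Qed.

Let ab : a != b. Proof. exact: lo_neq_hi. Qed.
Let bc : b != c. Proof. rewrite hi_lo; exact: lo_neq_hi. Qed.
Let ac : a != c.
Proof. by rewrite -val_eqE /= adj neq_ltn ltnS leqnSn. Qed.

Lemma swap1X : [/\ s1 'X_a = 'X_b, s1 'X_b = 'X_a & s1 'X_c = 'X_c].
Proof. by rewrite !swapX tpermL tpermR tpermD. Qed.

Lemma swap2X : [/\ s2 'X_a = 'X_a, s2 'X_b = 'X_c & s2 'X_c = 'X_b].
Proof.
by rewrite !swapX -hi_lo tpermL tpermR tpermD // eq_sym.
Qed.

Lemma swap_braid f : s1 (s2 (s1 f)) = s2 (s1 (s2 f)).
Proof.
have conj (s t : 'S_n) : s^-1%g = s -> (s * t * s = t ^ s)%g.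
  by move=> sV; rewrite conjgE sV mulgA.
rewrite /swap -!msymMm -hi_lo !mulgA !conj ?tpermV // !tpermJ.
by rewrite !tpermL !tpermR !tpermD // eq_sym.
Qed.

Lemma swapXn k f m : swap k (f ^+ m) = swap k f ^+ m :> {mpoly K[n]}.
Proof. exact: (rmorphXn (msym _)). Qed.

(* The six permutations of three variables map this monomial to six distinct
   ones, so its powers separate them. *)
Definition monom12 (p : 'I_n * 'I_n) : {mpoly K[n]} := 'X_p.1 * 'X_p.2 ^+ 2.

Lemma monom12_inj : injective monom12.
Proof.
move=> [p q] [p' q'] /= E.
have qq' : q = q'.
  move: E; rewrite /monom12 /= !expr2 -!mpolyXD => /mpolyXm_inj.
  move/(congr1 (fun u : 'X_{1..n} => u q)); rewrite !mnmDE !mnm1E eqxx.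
  by case: (q' =P q) => // _; case: (p == q); case: (p' == q).
congr (_, _) => //; move: E; rewrite /monom12 /= qq'.
move/mulIf => E; apply/mpolyX_inj/E; rewrite expf_neq0 //.
apply/eqP => /(congr1 (mcoeff U_(q'))) /eqP.
by rewrite mcoeffX eqxx mcoeff0 oner_eq0.
Qed.

(** Swaps are multiplicative, so on the powers of one monomial the hypothesis becomes the vanishing
    of weighted power sums of its six distinct images. *)
Lemma swap_words_free (C0 C1 C2 C12 C21 C121 : F) :
  (forall f, C0 * tau f + C1 * tau (s1 f) + C2 * tau (s2 f)
     + C12 * tau (s1 (s2 f)) + C21 * tau (s2 (s1 f))
     + C121 * tau (s1 (s2 (s1 f))) = 0) ->
  [/\ C0 = 0, C1 = 0, C2 = 0 & [/\ C12 = 0, C21 = 0 & C121 = 0]].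
Proof.
move=> E; pose C := [:: C0; C1; C2; C12; C21; C121].
(* Listed in the order of [C]: each pair is the image of (a, b) under the word that its coefficient
   multiplies. *)
pose ps := [:: (a, b); (b, a); (a, c); (b, c); (c, a); (c, b)].
pose e := [seq tau (monom12 p) | p <- ps].
have uniq_e : uniq e.
  rewrite map_inj_uniq; last first.
    by move=> p q /eqP; rewrite tofrac_eq => /eqP/monom12_inj.
  rewrite /= !inE !xpair_eqE !eqxx (negPf ab) (negPf bc) (negPf ac).
  rewrite [b == a]eq_sym [c == a]eq_sym [c == b]eq_sym.
  by rewrite (negPf ab) (negPf bc) (negPf ac).
have Cnth (k : 'I_6) : C`_k = 0.
  apply: (@power_sums_eq0 _ _ (fun k : 'I_6 => C`_k) (fun k : 'I_6 => e`_k)).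
    by move=> k1 k2 /eqP; rewrite nth_uniq // => /eqP/val_inj.
  move=> m; rewrite !big_ord_recr big_ord0 /= add0r.
  have := E (monom12 (a, b) ^+ m).
  have [s1a s1b s1c] := swap1X; have [s2a s2b s2c] := swap2X.
  have sM k' p : swap k' (monom12 p) = swap k' 'X_p.1 * swap k' 'X_p.2 ^+ 2.
    by rewrite swapM swapXn.
  rewrite !swapXn.
  have w1 : s1 (monom12 (a, b)) = monom12 (b, a) by rewrite sM s1a s1b.
  have w2 : s2 (monom12 (a, b)) = monom12 (a, c) by rewrite sM s2a s2b.
  have w12 : s1 (monom12 (a, c)) = monom12 (b, c) by rewrite sM s1a s1c.
  have w21 : s2 (monom12 (b, a)) = monom12 (c, a) by rewrite sM s2a s2b.
  have w121 : s1 (monom12 (c, a)) = monom12 (c, b) by rewrite sM s1a s1c.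
  by rewrite !(w1, w2, w12, w21, w121) !(rmorphXn tau).
have Cm (m : nat) (m6 : (m < 6)%N) : C`_m = 0 by exact: (Cnth (Ordinal m6)).
by split; [exact: (Cm 0)|exact: (Cm 1)|exact: (Cm 2)|
  split; [exact: (Cm 3)|exact: (Cm 4)|exact: (Cm 5)]].
Qed.

End Braid.

(** * Coefficients of the braid relation *)

(* h, hh, hhh are the results of applying pi_1, pi_2 pi_1, pi_1 pi_2 pi_1 to f,
   and k, kk, kkk those of pi_2, pi_1 pi_2, pi_2 pi_1 pi_2; the digits after a
   letter name the transpositions applied afterwards, the leftmost one last. *)
Lemma braid_word_expansion (R : comNzRingType)
  (t12 t13 t21 t23 m12 m13 m21 m23 t12' t13' t23' t32' n12 n13 n23 n32 : R)
  (f f1 f2 f12 f21 f121 h h1 h2 h12 hh hh1 hhh k k1 k2 k21 kk kk2 kkk : R) :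
  h = t12 * f - m12 * f1 -> h1 = t21 * f1 - m21 * f ->
  h2 = t13 * f2 - m13 * f21 -> h12 = t23 * f12 - m23 * f121 ->
  hh = t23' * h - n23 * h2 -> hh1 = t13' * h1 - n13 * h12 ->
  hhh = t12 * hh - m12 * hh1 ->
  k = t23' * f - n23 * f2 -> k2 = t32' * f2 - n32 * f ->
  k1 = t13' * f1 - n13 * f12 -> k21 = t12' * f21 - n12 * f121 ->
  kk = t12 * k - m12 * k1 -> kk2 = t13 * k2 - m13 * k21 ->
  kkk = t23' * kk - n23 * kk2 ->
  hhh - kkk =
    (t12 * t12 * t23' + m12 * m21 * t13'
     - (t23' * t23' * t12 + n23 * n32 * t13)) * f
    + m12 * (t23' * t13' - t12 * t23' - t13' * t21) * f1
    + n23 * (t23' * t12 + t13 * t32' - t12 * t13) * f2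
    + m12 * n13 * (t23 - t23') * f12 + n23 * m13 * (t12 - t12') * f21
    + (n23 * m13 * n12 - m12 * n13 * m23) * f121.
Proof. by move=> -> -> -> -> -> -> -> -> -> -> -> -> -> ->; ring. Qed.

Lemma div_comb (F : fieldType) (d t m f f' : F) : d != 0 ->
  t * f - m * f' = d * (t / d * f - m / d * f').
Proof. by move=> d0; field. Qed.

Section Braid.
Variables (K : fieldType) (n : nat).
Local Notation F := {fraction {mpoly K[n]}}.
Local Notation tau := (@tofrac {mpoly K[n]}).
Implicit Types (f g h : {mpoly K[n]}) (T M N : {poly {poly K}}) (p q : 'I_n).

Definition cf T p q : F :=
  tau (evm 'X_p 'X_q T) / (tau 'X_p - tau 'X_q).

(** The relation [acts] carried to variables p and q by a permutation, with f' the image of the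
    swapped argument; further swaps preserve this shape. *)
Definition twisted T M p q f f' g :=
  ('X_p - 'X_q) * g = evm 'X_p 'X_q T * f - evm 'X_p 'X_q M * f'.

Lemma tau_inj : injective tau.
Proof. by move=> f g /eqP; rewrite tofrac_eq => /eqP. Qed.

Lemma tauX_neq p q : p != q -> tau 'X_p - tau 'X_q != 0.
Proof.
by move=> pq; rewrite -rmorphB tofrac_eq0 subX_neq0.
Qed.

Lemma twisted_frac T M p q f f' g : p != q -> twisted T M p q f f' g ->
  tau g = cf T p q * tau f - cf M p q * tau f'.
Proof.
move=> pq /(congr1 tau); rewrite tofracM !tofracB !tofracM => E.
exact: (mulfI (tauX_neq pq) (etrans E (div_comb _ _ _ _ (tauX_neq pq)))).
Qed.

Lemma twisted_swap k T M p q p' q' f f' g :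
  swap k ('X_p : {mpoly K[n]}) = 'X_p' ->
  swap k ('X_q : {mpoly K[n]}) = 'X_q' ->
  twisted T M p q f f' g ->
  twisted T M p' q' (swap k f) (swap k f') (swap k g).
Proof.
move=> Ep Eq /(congr1 (swap k)).
by rewrite !(swapB, swapM) !swap_evm Ep Eq.
Qed.

Variables i j : 'I_n.-1.
Hypothesis adj : j = i.+1 :> nat.
Local Notation a := (lo i).
Local Notation b := (hi i).
Local Notation c := (hi j).
Local Notation s1 := (@swap K n i).
Local Notation s2 := (@swap K n j).

(** In order, the coefficients of 1, s1, s2, s1 s2, s2 s1 and s1 s2 s1 in the difference of the two
    sides. *)
Definition braid_equations T M T' N :=
  [/\ cf T a b * cf T a b * cf T' b c + cf M a b * cf M b a * cf T' a c
      - (cf T' b c * cf T' b c * cf T a b + cf N b c * cf N c b * cf T a c) = 0,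
      cf M a b * (cf T' b c * cf T' a c - cf T a b * cf T' b c
                  - cf T' a c * cf T b a) = 0,
      cf N b c * (cf T' b c * cf T a b + cf T a c * cf T' c b
                  - cf T a b * cf T a c) = 0
    & [/\ cf M a b * cf N a c * (cf T b c - cf T' b c) = 0,
      cf N b c * cf M a c * (cf T a b - cf T' a b) = 0
    & cf N b c * cf M a c * cf N a b - cf M a b * cf N a c * cf M b c = 0]].

(** [braid_word_expansion] writes the difference of the two sides in the six words, and
    [swap_words_free] separates them. *)
Lemma braid_iff T M T' N pi1 pi2 : acts i T M pi1 -> acts j T' N pi2 ->
  (forall f, pi1 (pi2 (pi1 f)) = pi2 (pi1 (pi2 f))) <->
  braid_equations T M T' N.
Proof.
move=> A1 A2.
have ab : a != b := lo_neq_hi i.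
have bc : b != c by rewrite (hi_lo adj) lo_neq_hi.
have ac : a != c by rewrite -val_eqE /= adj neq_ltn ltnS leqnSn.
have ba : b != a by rewrite eq_sym.
have cb : c != b by rewrite eq_sym.
have [s1a s1b s1c] := swap1X K adj; have [s2a s2b s2c] := swap2X K adj.
have B1 f : twisted T M a b f (s1 f) (pi1 f) := A1 f.
have B2 f : twisted T' N b c f (s2 f) (pi2 f).
  by have := A2 f; rewrite /xlo -(hi_lo adj).
have B1' f : twisted T M b a (s1 f) f (s1 (pi1 f)).
  by rewrite -{2}[f](swapK i); apply: twisted_swap (B1 f).
have B2' f : twisted T' N c b (s2 f) f (s2 (pi2 f)).
  by rewrite -{2}[f](swapK j); apply: twisted_swap (B2 f).
(* Transport by s2 s1 ends in s2 s1 s2; the braid relation of the swaps turns it into the word used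
   on the other side. *)
have B21 f : twisted T' N a b (s2 (s1 f)) (s1 (s2 (s1 f))) (s2 (s1 (pi2 f))).
  rewrite (swap_braid adj).
  exact: twisted_swap s2a s2c (twisted_swap s1b s1c (B2 f)).
have E f := braid_word_expansion
  (twisted_frac ab (B1 f)) (twisted_frac ba (B1' f))
  (twisted_frac ac (twisted_swap s2a s2b (B1 f)))
  (twisted_frac bc (twisted_swap s1a s1c (twisted_swap s2a s2b (B1 f))))
  (twisted_frac bc (B2 (pi1 f)))
  (twisted_frac ac (twisted_swap s1b s1c (B2 (pi1 f))))
  (twisted_frac ab (B1 (pi2 (pi1 f))))
  (twisted_frac bc (B2 f)) (twisted_frac cb (B2' f))
  (twisted_frac ac (twisted_swap s1b s1c (B2 f)))
  (twisted_frac ab (B21 f))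
  (twisted_frac ab (B1 (pi2 f)))
  (twisted_frac ac (twisted_swap s2a s2b (B1 (pi2 f))))
  (twisted_frac bc (B2 (pi1 (pi2 f)))).
split=> [braid | [E0 E1 E2 [E12 E21 E121]] f]; last first.
  apply: tau_inj; apply/eqP; rewrite -subr_eq0 E E0 E1 E2 E12 E21 E121.
  by rewrite !mul0r !addr0.
have zero f := etrans (esym (E f))
  (etrans (congr1 (fun g => tau g - _) (braid f)) (subrr _)).
by have [E0 E1 E2 [E12 E21 E121]] := swap_words_free adj zero.
Qed.

End Braid.

(** * Clearing denominators *)

Section ClearDenominators.
Variables (F : fieldType) (x y z : F).
Hypotheses (xy : x - y != 0) (yz : y - z != 0) (xz : x - z != 0).

Let yx : y - x != 0. Proof. by rewrite -opprB oppr_eq0. Qed.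
Let zy : z - y != 0. Proof. by rewrite -opprB oppr_eq0. Qed.
Let D := (x - y) * (y - z) * (x - z).
Let D0 : D != 0. Proof. by rewrite !mulf_neq0. Qed.

Lemma clear_left t12 t13 t21 t23 :
  (t23 / (y - z) * (t13 / (x - z)) - t12 / (x - y) * (t23 / (y - z))
   - t13 / (x - z) * (t21 / (y - x)) = 0) <->
  (t12 * t23 * (x - z) - t13 * t21 * (y - z) = t23 * t13 * (x - y)).
Proof.
set L := (X in X = 0); have LE : L * D =
  t23 * t13 * (x - y) - (t12 * t23 * (x - z) - t13 * t21 * (y - z)).
  by rewrite /L /D; field; rewrite ?xy ?yz ?xz ?yx.
split=> [L0|E]; last by apply: (mulIf D0); rewrite LE E subrr mul0r.
by apply/esym/eqP; rewrite -subr_eq0 -LE L0 mul0r.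
Qed.

Lemma clear_right t12 t13 t23 t32 :
  (t23 / (y - z) * (t12 / (x - y)) + t13 / (x - z) * (t32 / (z - y))
   - t12 / (x - y) * (t13 / (x - z)) = 0) <->
  (t12 * t13 * (y - z) = t23 * t12 * (x - z) - t13 * t32 * (x - y)).
Proof.
set L := (X in X = 0); have LE : L * D =
  t23 * t12 * (x - z) - t13 * t32 * (x - y) - t12 * t13 * (y - z).
  by rewrite /L /D; field; rewrite ?xy ?yz ?xz ?zy.
split=> [L0|E]; last by apply: (mulIf D0); rewrite LE E subrr mul0r.
by apply/esym/eqP; rewrite -subr_eq0 -LE L0 mul0r.
Qed.

Lemma clear_norm u v :
  (u / (x - y) ^+ 2 - v / (y - z) ^+ 2 = 0) <->
  ((y - z) ^+ 2 * u = (x - y) ^+ 2 * v).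
Proof.
set L := (X in X = 0); pose d := (x - y) ^+ 2 * (y - z) ^+ 2.
have d0 : d != 0 by rewrite mulf_neq0 ?expf_neq0.
have LE : L * d = (y - z) ^+ 2 * u - (x - y) ^+ 2 * v.
  by rewrite /L /d; field; rewrite ?xy ?yz.
split=> [L0|E]; last by apply: (mulIf d0); rewrite LE E subrr mul0r.
by apply/eqP; rewrite -subr_eq0 -LE L0 mul0r.
Qed.

Lemma clear_long m12 m13 m23 n12 n13 n23 :
  (n23 / (y - z) * (m13 / (x - z)) * (n12 / (x - y))
   - m12 / (x - y) * (n13 / (x - z)) * (m23 / (y - z)) = 0) <->
  (m12 * n13 * m23 = n23 * m13 * n12).
Proof.
set L := (X in X = 0); have LE : L * D = n23 * m13 * n12 - m12 * n13 * m23.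
  by rewrite /L /D; field; rewrite ?xy ?yz ?xz.
split=> [L0|E]; last by apply: (mulIf D0); rewrite LE E subrr mul0r.
by apply/esym/eqP; rewrite -subr_eq0 -LE L0 mul0r.
Qed.

End ClearDenominators.

(** * From the six coefficients to polynomial identities *)

Section Identities.
Variables (K : fieldType) (n : nat).
Local Notation tau := (@tofrac {mpoly K[n]}).
Local Notation U := ('X%:P : {poly {poly K}}).
Local Notation V := ('X : {poly {poly K}}).
Implicit Types (P T M N : {poly {poly K}}) (p q r : 'I_n).

(** Turns an identity between the variables x_a, x_b, x_c into one for arbitrary x, y, z in
    K[u][v]. *)
Lemma specialization (v : 'I_n -> {poly {poly K}}) :
  exists2 theta : {rmorphism {mpoly K[n]} -> {poly {poly K}}},
    forall k, theta 'X_k = v k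
    & forall g h P, theta (evm g h P) = evb (theta g) (theta h) P.
Proof.
pose th : {rmorphism {mpoly K[n]} -> {poly {poly K}}} := mmap (@polyCC K) v.
exists th => [k|g h P]; first by rewrite /th /= mmapX mmap1U.
apply: (@ev_comp K {mpoly K[n]} {poly {poly K}} (@mpolyC n K) (@polyCC K) th).
by move=> k; rewrite /th /= mmapC.
Qed.

Lemma evm_eq0 p q P : p != q -> evm 'X_p 'X_q P = 0 -> P = 0.
Proof.
move=> pq E.
have [th thX thE] := specialization (fun k => if k == p then U else V).
rewrite -[LHS]evb_id; have := thE 'X_p 'X_q P.
by rewrite E rmorph0 !thX eqxx eq_sym (negPf pq) => <-.
Qed.

Lemma cf_neq0 p q P : p != q -> P != 0 -> cf P p q != 0.
Proof.
move=> pq P0; rewrite mulf_neq0 ?invr_eq0 ?tauX_neq // tofrac_eq0.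
by apply: contra_neq P0; apply: evm_eq0.
Qed.

Variables i j : 'I_n.-1.
Hypothesis adj : j = i.+1 :> nat.
Local Notation a := (lo i).
Local Notation b := (hi i).
Local Notation c := (hi j).

Let ab : a != b := lo_neq_hi i.
Let bc : b != c. Proof. rewrite (hi_lo adj); exact: lo_neq_hi. Qed.
Let ac : a != c.
Proof. by rewrite -val_eqE /= adj neq_ltn ltnS leqnSn. Qed.

Lemma cf_norm T p q : cf T p q * cf T q p =
  - (tau (evm 'X_p 'X_q T * evm 'X_q 'X_p T)) / ((tau 'X_p - tau 'X_q) ^+ 2).
Proof.
rewrite /cf tofracM -[tau 'X_q - _]opprB invrN expr2 invfM.
by rewrite mulrN mulrN !mulNr mulrACA.
Qed.

Let xy := tauX_neq K ab.
Let yz := tauX_neq K bc.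
Let xz := tauX_neq K ac.
Local Notation tauE := (tofracM, tofracB, tofracXn).

Lemma left_iff T :
  cf T b c * cf T a c - cf T a b * cf T b c - cf T a c * cf T b a = 0 <->
  evm 'X_a 'X_b T * evm 'X_b 'X_c T * ('X_a - 'X_c)
    - evm 'X_a 'X_c T * evm 'X_b 'X_a T * ('X_b - 'X_c)
  = evm 'X_b 'X_c T * evm 'X_a 'X_c T * ('X_a - 'X_b).
Proof.
rewrite /cf; split=> [/(clear_left xy yz xz) E|/(congr1 tau) E].
  by apply: tau_inj; rewrite !tauE.
by apply/(clear_left xy yz xz); rewrite -!tauE.
Qed.

Lemma right_iff T :
  cf T b c * cf T a b + cf T a c * cf T c b - cf T a b * cf T a c = 0 <->
  evm 'X_a 'X_b T * evm 'X_a 'X_c T * ('X_b - 'X_c) =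
  evm 'X_b 'X_c T * evm 'X_a 'X_b T * ('X_a - 'X_c)
    - evm 'X_a 'X_c T * evm 'X_c 'X_b T * ('X_a - 'X_b).
Proof.
rewrite /cf; split=> [/(clear_right xy yz xz) E|/(congr1 tau) E].
  by apply: tau_inj; rewrite !tauE.
by apply/(clear_right xy yz xz); rewrite -!tauE.
Qed.

Lemma long_iff M N :
  cf N b c * cf M a c * cf N a b - cf M a b * cf N a c * cf M b c = 0 <->
  evm 'X_a 'X_b M * evm 'X_a 'X_c N * evm 'X_b 'X_c M
  = evm 'X_b 'X_c N * evm 'X_a 'X_c M * evm 'X_a 'X_b N.
Proof.
rewrite /cf; split=> [/(clear_long xy yz xz) E|/(congr1 tau) E].
  by apply: tau_inj; rewrite !tauE.
by apply/(clear_long xy yz xz); rewrite -!tauE.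
Qed.

Lemma norm_iff T M N :
  cf M a b * cf M b a - cf T a b * cf T b a
    - (cf N b c * cf N c b - cf T b c * cf T c b) = 0 <->
  ('X_b - 'X_c) ^+ 2 *
    (evm 'X_a 'X_b T * evm 'X_b 'X_a T - evm 'X_a 'X_b M * evm 'X_b 'X_a M)
  = ('X_a - 'X_b) ^+ 2 *
    (evm 'X_b 'X_c T * evm 'X_c 'X_b T - evm 'X_b 'X_c N * evm 'X_c 'X_b N).
Proof.
have normE p q P Q : cf P p q * cf P q p - cf Q p q * cf Q q p =
    tau (evm 'X_p 'X_q Q * evm 'X_q 'X_p Q - evm 'X_p 'X_q P * evm 'X_q 'X_p P)
    / (tau 'X_p - tau 'X_q) ^+ 2.
  by rewrite !cf_norm -mulrBl tofracB opprK addrC.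
rewrite !normE; split=> [/(clear_norm xy yz) E|/(congr1 tau) E].
  by apply: tau_inj; rewrite tofracM [RHS]tofracM !tofracXn 2!(tofracB 'X__).
apply/(clear_norm xy yz); move: E.
by rewrite tofracM [X in _ = X]tofracM !tofracXn 2!(tofracB 'X__).
Qed.

(** Modulo the two Yang-Baxter expressions, the coefficient of the identity is a multiple of the
    norm comparison between the neighbours. *)
Lemma norm_combination T M N :
  cf T a b * cf T a b * cf T b c + cf M a b * cf M b a * cf T a c
    - (cf T b c * cf T b c * cf T a b + cf N b c * cf N c b * cf T a c) =
  cf T a c * (cf M a b * cf M b a - cf T a b * cf T b a
              - (cf N b c * cf N c b - cf T b c * cf T c b))
  - cf T a b * (cf T b c * cf T a c - cf T a b * cf T b c - cf T a c * cf T b a)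
  - cf T b c * (cf T b c * cf T a b + cf T a c * cf T c b
                - cf T a b * cf T a c).
Proof. by move: (@cf K n) => t; ring. Qed.

(** As T, M, N are nonzero, the common factors cancel. Then s1 s2 yields T' = T, s1 and s2 the
    Yang-Baxter identities, 1 the norm comparison and s1 s2 s1 the cubic relation. *)
Lemma braid_equations_necessary T M T' N :
  T != 0 -> M != 0 -> N != 0 -> braid_equations i j T M T' N ->
  [/\ T' = T, yang_baxter T /\ yang_baxter (swapXY T),
      forall x y z, (y - z) ^+ 2 * evb x y (T * swapXY T - M * swapXY M)
                  = (x - y) ^+ 2 * evb y z (T * swapXY T - N * swapXY N)
    & forall x y z, evb x y M * evb x z N * evb y z M
                  = evb y z N * evb x z M * evb x y N].
Proof.
move=> T0 M0 N0 [E0 E1 E2 [E12 _ E121]].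
have ET : T' = T.
  apply/eqP; rewrite -subr_eq0; apply/eqP; apply: (evm_eq0 bc); rewrite evmB.
  have nz := mulf_neq0 (cf_neq0 ab M0) (cf_neq0 ac N0).
  have /subr0_eq E := mulfI nz (etrans E12 (esym (mulr0 _))).
  apply/eqP; rewrite subr_eq0; apply/eqP/tau_inj/esym.
  exact: (mulIf (invr_neq0 yz) E).
move: E0 E1 E2; rewrite {}ET norm_combination => E0 E1 E2.
have {}E1 := mulfI (cf_neq0 ab M0) (etrans E1 (esym (mulr0 _))).
have {}E2 := mulfI (cf_neq0 bc N0) (etrans E2 (esym (mulr0 _))).
rewrite E1 E2 !mulr0 !subr0 in E0.
have {}E0 := mulfI (cf_neq0 ac T0) (etrans E0 (esym (mulr0 _))).
have spec x y z : exists2 th : {rmorphism {mpoly K[n]} -> {poly {poly K}}},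
    [/\ th 'X_a = x, th 'X_b = y & th 'X_c = z]
    & forall g h P, th (evm g h P) = evb (th g) (th h) P.
  have [th thX thE] :=
    specialization (fun k => if k == a then x else if k == b then y else z).
  exists th => //; rewrite !thX !eqxx; split=> //.
    by rewrite eq_sym (negPf ab).
  by rewrite eq_sym (negPf ac) eq_sym (negPf bc).
have flip (R : comNzRingType) (x y z p q r s : R) :
    p * q * (y - z) = r * p * (x - z) - q * s * (x - y) ->
    r * p * (z - x) - q * s * (y - x) = p * q * (z - y).
  by move=> E; rewrite -(opprB y z) mulrN E; ring.
split=> //.
- split=> x y z.
    have [th [<- <- <-] thE] := spec x y z; rewrite -!thE.
    move/left_iff/(congr1 th): E1.
    by rewrite (rmorphB th) !(rmorphM th) !(rmorphB th).
  (* Reversing the three variables turns the equation of s2 into the identity for T(v,u). *)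
  have [th [<- <- <-] thE] := spec z y x; rewrite !evb_swapXY -!thE.
  move/right_iff/(congr1 th): E2.
  by rewrite (rmorphB th) !(rmorphM th) !(rmorphB th); apply: flip.
- move=> x y z; have [th [<- <- <-] thE] := spec x y z.
  move/norm_iff/(congr1 th): E0.
  rewrite !evbB !evbM !evb_swapXY -!thE.
  by rewrite !(rmorphM th) ?(rmorphXn th) !(rmorphB th) !(rmorphM th).
- move=> x y z; have [th [<- <- <-] thE] := spec x y z; rewrite -!thE.
  by move/long_iff/(congr1 th): E121; rewrite !(rmorphM th).
Qed.

Lemma braid_equations_sufficient T M N :
  cf T b c * cf T a c - cf T a b * cf T b c - cf T a c * cf T b a = 0 ->
  cf T b c * cf T a b + cf T a c * cf T c b - cf T a b * cf T a c = 0 ->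
  cf M a b * cf M b a - cf T a b * cf T b a
    - (cf N b c * cf N c b - cf T b c * cf T c b) = 0 ->
  cf N b c * cf M a c * cf N a b - cf M a b * cf N a c * cf M b c = 0 ->
  braid_equations i j T M T N.
Proof.
move=> E1 E2 E0 E3.
split; rewrite ?norm_combination ?E0 ?E1 ?E2 ?mulr0 ?subr0 //.
by split; rewrite ?subrr ?mulr0.
Qed.

End Identities.

(** * The two cases *)

Section Sufficiency.
Variables (K : fieldType) (n : nat) (i j : 'I_n.-1).
Hypothesis adj : j = i.+1 :> nat.
Variables al be ga de : K.
Local Notation a := (lo i).
Local Notation b := (hi i).
Local Notation c := (hi j).
Local Notation T := (linU al be * linV ga de).

Lemma evm_linU (x y : {mpoly K[n]}) (p q : K) :
  evm x y (linU p q) = p%:MP * x + q%:MP.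
Proof. by rewrite /linU evmD evmM evmU !evmCC. Qed.

Lemma evm_linV (x y : {mpoly K[n]}) (p q : K) :
  evm x y (linV p q) = p%:MP * y + q%:MP.
Proof. by rewrite /linV evmD evmM evmV !evmCC. Qed.

(** A linear factor in u times one in v satisfies both Yang-Baxter identities, which leaves the norm
    and cubic conditions. *)
Lemma lin_braid (M N : {poly {poly K}}) :
  ('X_b - 'X_c) ^+ 2 *
    (evm 'X_a 'X_b T * evm 'X_b 'X_a T - evm 'X_a 'X_b M * evm 'X_b 'X_a M)
  = ('X_a - 'X_b) ^+ 2 *
    (evm 'X_b 'X_c T * evm 'X_c 'X_b T - evm 'X_b 'X_c N * evm 'X_c 'X_b N) ->
  evm 'X_a 'X_b M * evm 'X_a 'X_c N * evm 'X_b 'X_c M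
  = evm 'X_b 'X_c N * evm 'X_a 'X_c M * evm 'X_a 'X_b N ->
  braid_equations i j T M T N.
Proof.
move=> E0 E3; apply: braid_equations_sufficient.
- apply/(left_iff adj); rewrite !evmM !evm_linU !evm_linV; ring.
- apply/(right_iff adj); rewrite !evmM !evm_linU !evm_linV; ring.
- exact/(norm_iff adj).
- exact/(long_iff adj).
Qed.

Definition lin_product (M : {poly {poly K}}) :=
  [\/ M = linU al be * linV ga de, M = linV al be * linU ga de,
      M = linU al be * linU ga de | M = linV al be * linV ga de].

(** All four products have the norm of T, so both sides of the norm condition are 0. The cubic
    relation holds for all sixteen pairs, so neighbours may choose independently. *)
Lemma lin_product_braid M N : lin_product M -> lin_product N ->
  braid_equations i j T M T N.
Proof.
move=> HM HN; apply: lin_braid.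
  by case: HM => ->; case: HN => ->; rewrite !(evmM, evm_linU, evm_linV); ring.
by case: HM => ->; case: HN => ->; rewrite !(evmM, evm_linU, evm_linV); ring.
Qed.

(** The norms of T and M differ by a constant times (u - v)^2, and with equal neighbours the cubic
    relation is commutativity. *)
Lemma bil_lin_braid e
    (M := bil (al * ga) (be * ga + e) (al * de - e) (be * de)) :
  braid_equations i j T M T M.
Proof.
apply: lin_braid; rewrite ?evmM ?evm_linU ?evm_linV !evm_bil.
  by rewrite !(mpolyCD, mpolyCB, mpolyCM); ring.
by ring.
Qed.

End Sufficiency.

Lemma adjacent_const (X : Type) m (F : 'I_m -> X) :
  (forall i j : 'I_m, j = i.+1 :> nat -> F i = F j) -> forall i j, F i = F j.
Proof.
move=> step; case: m F step => [|m] F step; first by case.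
suff F0 k (km : (k < m.+1)%N) : F (Ordinal km) = F ord0.
  by move=> [k km] [l lm]; rewrite !F0.
elim: k km => [|k IH] km; first by congr F; apply: val_inj.
by rewrite -(step (Ordinal (ltnW km))) ?IH.
Qed.

Section Bipoly.
Variable K : fieldType.
Local Notation U := ('X%:P : {poly {poly K}}).
Local Notation V := ('X : {poly {poly K}}).

Lemma bipoly_eq0 (P : {mpoly K[2]}) : bipoly P = 0 -> P = 0.
Proof.
move=> E; have := evm_bipoly (varu K) (varv K) P; rewrite E [LHS]rmorph0.
suff -> : ev2 P (varu K) (varv K) = P by [].
rewrite /ev2 -[RHS]comp_mpoly_id; congr (_ \mPo _).
apply: eq_from_tnth => k; rewrite tnth_mktuple (tnth_nth 0) /varu /varv.
by case: k => -[|[|//]] k; congr 'X__; apply: val_inj.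
Qed.

(** For u = v the multiples of u - v vanish and P(v,u) meets P(u,v). The diagonal settles the sign
    of Q_0, which its norm leaves open. *)
Lemma bipoly_diag (P Q R S : {mpoly K[2]}) :
  evb U U (bipoly (polyQ0 P Q S)) = evb U U (bipoly (polyT P Q R)).
Proof.
have [th thX thE] := specialization (fun _ : 'I_2 => U).
rewrite -{1 2 3 4}(thX ord0) -!thE; congr (th _).
rewrite !evm_bipoly /polyT /polyQ0 !(ev2B, ev2D, ev2M).
by rewrite ev2_ev2 !ev2u !ev2v subrr !mul0r addr0 subr0.
Qed.

Lemma positive0 : ddiff_positive (0 : {mpoly K[2]}).
Proof. by move=> m; rewrite msupp0. Qed.

Lemma positiveX k c : (0 < k)%N -> ddiff_positive (c *: varu K ^+ k).
Proof.
move=> k0 m /msuppZ_le; rewrite /varu mpolyXn msuppX inE => /eqP ->.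
by rewrite !mulmnE !mnm1E /= mul1n mul0n.
Qed.

Lemma positiveD (P Q : {mpoly K[2]}) :
  ddiff_positive P -> ddiff_positive Q -> ddiff_positive (P + Q).
Proof.
by move=> hP hQ m /msuppD_le; rewrite mem_cat => /orP[/hP|/hQ].
Qed.

End Bipoly.

(** * The triples of the theorem in terms of T and Q_0 *)

Section Presentation.
Variables (K : fieldType) (n : nat).
Implicit Types pi : 'I_n.-1 -> {mpoly K[n]} -> {mpoly K[n]}.

Lemma bil_lin (al be ga de : K) :
  bil (al * ga) (al * de) (be * ga) (be * de) = linU al be * linV ga de.
Proof. by rewrite bilE /linU /linV !polyCCM; ring. Qed.

Local Notation ev2E := (ev2B, ev2D, ev2M, ev2Z, ev2C, ev2_0, ev2u, ev2v).

Section Presentations.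
Variables (i : 'I_n.-1) (pi : {mpoly K[n]} -> {mpoly K[n]}) (al be ga de : K).
Local Notation x := (xlo K i).
Local Notation y := (xhi K i).
Local Notation u := (varu K).
Local Notation v := (varv K).
Local Notation a := (al * ga).
Local Notation b := (al * de).
Local Notation c := (be * ga).
Local Notation d := (be * de).
Local Notation T := (linU al be * linV ga de).

(** This and the next three match the four products possible for Q_0 with the triples of case 2, by
    computing P + (u - v)R + Q and P(v,u) + Q. *)
Lemma presentation1 : acts i T (linV al be * linU ga de) pi <->
  forall f, pi f = pddo i (a *: (u * v) + b *: u + c *: v + d%:MP) 0 0 0 f.
Proof.
by apply: acts_presentation;
  rewrite !evmM !evm_linU !evm_linV !ev2E !mpolyCM; ring.
Qed.

Lemma presentation2 : acts i T T pi <->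
  forall f, pi f =
    pddo i (a *: (u * v) + c *: u + c *: v + d%:MP) ((b - c) *: u) 0 0 f.
Proof.
by apply: acts_presentation;
  rewrite !evmM !evm_linU !evm_linV !ev2E !(mpolyCB, mpolyCM); ring.
Qed.

Lemma presentation3 : acts i T (linV al be * linV ga de) pi <->
  forall f, pi f = pddo i (a *: u ^+ 2 + (b + c) *: u + c *: v + d%:MP)
    ((- c) *: u) ((- a) *: u) 0 f.
Proof.
by apply: acts_presentation;
  rewrite !(evmM, evm_linU, evm_linV) !ev2E !(mpolyCN, mpolyCD, mpolyCM); ring.
Qed.

Lemma presentation4 : acts i T (linU al be * linU ga de) pi <->
  forall f, pi f =
    pddo i (c *: v + d%:MP) (a *: u ^+ 2 + b *: u) ((- a) *: u) 0 f.
Proof.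
by apply: acts_presentation;
  rewrite !(evmM, evm_linU, evm_linV) !ev2E !(mpolyCN, mpolyCM); ring.
Qed.

Lemma presentation_shift e : acts i T (bil a (c + e) (b - e) d) pi <->
  forall f, pi f =
    pddo i (a *: (u * v) + (b - e) *: u + c *: v + d%:MP) (e *: u) 0 0 f.
Proof.
by apply: acts_presentation;
  rewrite !(evmM, evm_linU, evm_linV, evm_bil) !ev2E;
  rewrite !(mpolyCB, mpolyCD, mpolyCM); ring.
Qed.

End Presentations.

Lemma case1_braid pi : braid_case1 pi -> braid_relations pi.
Proof.
case=> [a [b [c [d [e [_ rk1 _ _ pres]]]]]].
have [al [be [ga [de [Ea Eb Ec Ed]]]]] := rank1_factor rk1.
subst a b c d => i j ij.
have A k := (presentation_shift k (pi k) al be ga de e).2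
  (let: And3 _ _ h := pres k in h).
exact/(braid_iff ij (A i) (A j))/bil_lin_braid.
Qed.

Lemma case2_braid pi : braid_case2 pi -> braid_relations pi.
Proof.
case=> [a [b [c [d [_ rk1 pres]]]]].
have [al [be [ga [de [Ea Eb Ec Ed]]]]] := rank1_factor rk1.
subst a b c d => i j ij.
have A k : exists2 M, acts k (linU al be * linV ga de) M (pi k)
    & lin_product al be ga de M.
  case: (pres k) => -[_ _ E].
  - by exists (linV al be * linU ga de); [apply/presentation1 | apply: Or42].
  - by exists (linU al be * linV ga de); [apply/presentation2 | apply: Or41].
  - by exists (linV al be * linV ga de); [apply/presentation3 | apply: Or44].
  - by exists (linU al be * linU ga de); [apply/presentation4 | apply: Or43].
have [M AM PM] := A i; have [N AN PN] := A j.
exact/(braid_iff ij AM AN)/lin_product_braid.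
Qed.

End Presentation.

(** * Necessity of the two cases *)

Section Necessity.
Variables (K : fieldType) (n : nat).
Hypothesis hn : (3 <= n)%N.
Variables (pi : 'I_n.-1 -> {mpoly K[n]} -> {mpoly K[n]})
  (T M : 'I_n.-1 -> {poly {poly K}}).
Hypotheses (pi_acts : forall i, acts i (T i) (M i) (pi i))
  (T0 : forall i, T i != 0) (M0 : forall i, M i != 0)
  (diag : forall i, evb ('X%:P) ('X%:P) (M i) = evb ('X%:P) ('X%:P) (T i)).
Local Notation U := ('X%:P : {poly {poly K}}).
Local Notation V := ('X : {poly {poly K}}).

Lemma braid_necessary : braid_relations pi -> braid_case1 pi \/ braid_case2 pi.
Proof.
move=> braid.
have pair (i j : 'I_n.-1) (ij : j = i.+1 :> nat) :=
  braid_equations_necessary ij (T0 i) (M0 i) (M0 j)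
    ((braid_iff ij (pi_acts i) (pi_acts j)).1 (braid i j ij)).
(* Since n is at least 3 there is a pair of neighbours, which supplies the identities for the common
   T. *)
have n1 : (0 < n.-1)%N by lia.
have n2 : (1 < n.-1)%N by lia.
pose i0 := Ordinal n1; pose i1 := Ordinal n2.
have ET i : T i = T i0.
  by apply: adjacent_const => k l kl; case: (pair k l kl).
have [_ [YB YB'] _ _] := pair i0 i1 erefl.
have [a [b [c [d [ETb rk1]]]]] := yang_baxter_bil YB YB'.
have nz : ~ [/\ a = 0, b = 0, c = 0 & d = 0].
  case=> a0 b0 c0 d0; move/eqP: (T0 i0); apply.
  by rewrite ETb a0 b0 c0 d0 bilE polyCC0 !mul0r !addr0.
have [al [be [ga [de [Ea Eb Ec Ed]]]]] := rank1_factor rk1.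
have ETl : T i0 = linU al be * linV ga de by rewrite ETb Ea Eb Ec Ed bil_lin.
pose Z i := T i0 * swapXY (T i0) - M i * swapXY (M i).
have ZS i : swapXY (Z i) = Z i := swapXY_norm_diff (T i0) (M i).
have Zpair (k l : 'I_n.-1) (kl : l = k.+1 :> nat) : exists kappa : K,
    Z k = polyCC kappa * (U - V) ^+ 2 /\ Z l = polyCC kappa * (U - V) ^+ 2.
  have [_ _] := pair k l kl; rewrite ET => cocycle _.
  exact: symmetric_square_cocycle (ZS k) cocycle.
have [kappa [EZ0 _]] := Zpair i0 i1 erefl.
have EZ i : Z i = polyCC kappa * (U - V) ^+ 2.
  rewrite -EZ0; apply: adjacent_const => k l kl.
  by have [kap [-> ->]] := Zpair k l kl.
(* If kappa = 0, each Q_0 has the norm of T and splits into linear factors: case 2. *)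
have [k0|k0] := eqVneq kappa 0.
  right; exists a, b, c, d; split=> // i.
  have norm : M i * swapXY (M i) =
      linU al be * linV ga de * swapXY (linU al be * linV ga de).
    apply/esym/eqP; rewrite -subr_eq0 -ETl.
    by rewrite -/(Z i) EZ k0 polyCC0 mul0r.
  have D : evb U U (M i) = evb U U (linU al be * linV ga de).
    by rewrite diag ET ETl.
  have nzT : linU al be * linV ga de != 0 by rewrite -ETl T0.
  have A := pi_acts i; rewrite ET ETl in A.
  have pZ k e : (0 < k)%N -> ddiff_positive (e *: varu K ^+ k) :=
    @positiveX K k e.
  have p0 := @positive0 K.
  case: (split_norm nzT norm D) => EM; rewrite EM in A.
  - apply: Or42; split=> //; first exact: (pZ 1%N).
    by rewrite Ea Eb Ec Ed; apply/presentation2.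
  - by apply: Or41; split=> //; rewrite Ea Eb Ec Ed; apply/presentation1.
  - apply: Or44; split.
    + by apply: positiveD; [exact: pZ | exact: (pZ 1%N)].
    + exact: (pZ 1%N).
    + by rewrite Ea Eb Ec Ed; apply/presentation4.
  - apply: Or43; split; [exact: (pZ 1%N)|exact: (pZ 1%N)|].
    by rewrite Ea Eb Ec Ed; apply/presentation3.
left.
have shift i : exists e, M i = bil a (c + e) (b - e) d.
  by apply: (bil_of_norm rk1 k0); rewrite -ETb ?diag ?ET // -/(Z i) EZ.
(* Every parameter occurring is a root of the same quadratic equation. *)
have norm e i : M i = bil a (c + e) (b - e) d -> e * (e - (b - c)) = kappa.
  move=> EM; have := EZ i; rewrite /Z EM ETb bil_norm_shift.
  by move/(mulIf (expf_neq0 2 (polyUV_neq0 K)))/polyCC_inj.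
have [e Ee] := shift i0; have Ne := norm _ _ Ee.
have EM i : M i = bil a (c + e) (b - e) d.
  rewrite -Ee; apply: adjacent_const => k l kl.
  have [e1 E1] := shift k; have [e2 E2] := shift l.
  have [_ _ _] := pair k l kl; rewrite E1 E2 => long.
  by rewrite (bil_braid_unique rk1 _ _ long) // (norm _ _ E1) ?(norm _ _ E2).
exists a, b, c, d, e; split=> //.
(* Both exclusions on e say that kappa = e (e - (b - c)) is nonzero. *)
- by move=> e0; move/eqP: k0; apply; rewrite -Ne e0 mul0r.
- by move=> e0; move/eqP: k0; apply; rewrite -Ne -e0 subrr mulr0.
move=> i; split; [exact: (@positiveX K 1%N)|exact: positive0|].
have A := pi_acts i; rewrite ET ETl EM in A.
by rewrite Ea Eb Ec Ed in A *; apply/presentation_shift.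
Qed.

End Necessity.

Theorem theorem19 (K : fieldType) (n : nat) (hn : (3 <= n)%N)
    (pi : 'I_n.-1 -> {mpoly K[n]} -> {mpoly K[n]})
    (P Q R S : 'I_n.-1 -> {mpoly K[2]})
    (hpi : forall i f, pi i f = pddo i (P i) (Q i) (R i) (S i) f)
    (hQ0 : forall i, polyQ0 (P i) (Q i) (S i) <> 0)
    (hT : forall i, polyT (P i) (Q i) (R i) <> 0) :
  braid_relations pi <-> braid_case1 pi \/ braid_case2 pi.
Proof.
split=> [|[]]; [|exact: case1_braid|exact: case2_braid].
apply: (braid_necessary hn (T := fun i => bipoly (polyT (P i) (Q i) (R i)))
  (M := fun i => bipoly (polyQ0 (P i) (Q i) (S i)))).
- by move=> i f; rewrite hpi; apply: acts_pddo.
- by move=> i; apply/eqP => /bipoly_eq0/hT.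
- by move=> i; apply/eqP => /bipoly_eq0/hQ0.
by move=> i; apply: bipoly_diag.
Qed.
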